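(* Let $0<\alpha<1$, $T>0$ and $J=[0,T]$. If $m:J\to\mathbb{R}$ is any differentiable function such that ${}^{ABC}{}_0\mathcal{D}_\tau^\alpha m\in C(J)$ and there exists $\tau_0\in(0,T]$ with $m(\tau_0)=0$ and $m(\tau)\ge 0$ for all $\tau\in[0,\tau_0)$, then ${}^{ABC}{}_0\mathcal{D}_\tau^\alpha m(\tau_0)\le 0$.
   Context: Let $0<\alpha<1$ and let $B$ be a fixed normalization function on $[0,1]$ with $B(\alpha)>0$ and $B(0)=B(1)=1$. The one-parameter Mittag-Leffler function is $\mathbb{E}_\alpha(z)=\sum_{n=0}^\infty \frac{z^n}{\Gamma(n\alpha+1)}$. For $\omega\in H^1(0,T)$ (Sobolev space), the left Atangana--Baleanu--Caputo (ABC) fractional derivative of order $\alpha$ is ${}^{ABC}{}_0\mathcal{D}_\tau^\alpha\omega(\tau)=\frac{B(\alpha)}{1-\alpha}\int_0^\tau \mathbb{E}_\alpha\left[-\frac{\alpha}{1-\alpha}(\tau-\sigma)^\alpha\right]\omega'(\sigma)\,d\sigma$. Functions to which this operator is applied are understood to lie in its domain. $C(J)$ denotes the real continuous functions on $J$. *)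

(* Defs.v *)
From mathcomp Require Import all_boot all_order all_algebra.
From mathcomp Require Import all_classical all_reals all_analysis.
Set Implicit Arguments.
Unset Strict Implicit.
Unset Printing Implicit Defensive.
Import Order.TTheory GRing.Theory Num.Theory.
Import numFieldNormedType.Exports.
Local Open Scope classical_set_scope.
Local Open Scope ring_scope.

(* Functions on an interval are represented by total functions R -> R; every
   definition below that mentions an interval only depends on the values taken
   on that interval. *)

Definition differentiable_on (R : realType) (J : set R) (f : R -> R) : Prop :=
  forall x, J x -> cvg ((f y - f x) / (y - x) @[y --> within J x^']).

Definition Gamma (R : realType) (x : R) : R :=
  \int[lebesgue_measure]_(t in `]0, +oo[) (t `^ (x - 1) * expR (- t)).

Definition mittag_leffler (R : realType) (alpha z : R) : R :=
  limn (series (fun n => z ^+ n / Gamma (n%:R * alpha + 1))).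

Definition smooth (R : realType) (f : R -> R) : Prop :=
  forall (n : nat) (x : R), derivable (derive1n n f) x 1.

(* C_c^oo(]0, T[), each function being extended by 0 to the real line. *)
Definition test_function (R : realType) (T : R) (phi : R -> R) : Prop :=
  let supp := closure [set x | phi x != 0] in
  [/\ smooth phi, compact supp & supp `<=` `]0, T[].

Definition L2 (R : realType) (T : R) (f : R -> R) : Prop :=
  f \_ `]0, T[ \in Lfun lebesgue_measure 2%:E.

Definition is_weak_derivative (R : realType) (T : R) (f g : R -> R) : Prop :=
  forall phi : R -> R, test_function T phi ->
    \int[lebesgue_measure]_(x in `]0, T[) (f x * derive1 phi x) =
    - \int[lebesgue_measure]_(x in `]0, T[) (g x * phi x).

Definition H1 (R : realType) (T : R) (f : R -> R) : Prop :=
  L2 T f /\ exists g : R -> R, L2 T g /\ is_weak_derivative T f g.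

(* A representative of the derivative of f in H^1(0, T); it is determined up to
   a null set of ]0, T[, hence so are the integrals below. *)
Definition weak_derivative (R : realType) (T : R) (f : R -> R) : R -> R :=
  get [set g : R -> R | L2 T g /\ is_weak_derivative T f g].

(* Left Atangana-Baleanu-Caputo derivative of f in H^1(0, T), at 0 <= tau <= T. *)
Definition ABC (R : realType) (B : R -> R) (alpha T : R) (f : R -> R) (tau : R)
    : R :=
  B alpha / (1 - alpha) *
  \int[lebesgue_measure]_(sigma in `[0, tau])
    (mittag_leffler alpha (- (alpha / (1 - alpha)) * (tau - sigma) `^ alpha) *
     weak_derivative T f sigma).

(* Main.v *)
Require Import Defs.
From mathcomp Require Import all_boot all_order all_algebra.
From mathcomp Require Import all_classical all_reals all_analysis.
From mathcomp Require Import measurable_realfun.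
From mathcomp Require Import ring lra.
Import Order.TTheory GRing.Theory Num.Theory.
Import numFieldNormedType.Exports.
Local Open Scope classical_set_scope.
Local Open Scope ring_scope.

(** Up to a positive factor, the fractional derivative at tau0 is the integral over
    [0, tau0] of k g, where g is the weak derivative of m and
    k sigma = E_alpha(- c (tau0 - sigma)^alpha), with c = alpha / (1 - alpha) >= 0.
    The proof combines two facts.

    The weight k is nonnegative and nondecreasing, that is, x |-> E_alpha(-x) is
    nonnegative and nonincreasing on [0, +oo[ (mittag_leffler_bounds).  This is a
    piece of the complete monotonicity of the Mittag-Leffler function, obtained here
    by discretization.  The function t |-> E_alpha(- x t^alpha) solves a fractional
    relaxation equation, and the implicit Euler scheme for it, with step 1/n, has the
    generating function D(z) = (1 - z)^(alpha - 1) / ((1 - z)^alpha + mu), where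
    mu = x / n^alpha.  As (1 - z)^alpha = 1 - b(z), where b has nonnegative
    coefficients, the coefficients of D are nonnegative and nonincreasing in mu
    (resolvent_coef_bounds).  Expanding D in powers of mu, the n-th coefficient is
    the sum over k of (- x)^k times n^(- k alpha) binom(n + k alpha, n), and Gauss's
    formula (cvg_gauss_ratio) says that n^(- k alpha) binom(n + k alpha, n) decreases
    to 1 / Gamma(k alpha + 1).  The monotone decrease gives the domination needed to
    exchange limit and sum, so that the coefficients converge to E_alpha(-x)
    (cvg_resolvent_mittag_leffler).  Gauss's formula itself follows from Euler's
    integral of t^x (1 - t/n)^n over [0, n], by monotone convergence.

    The integral of g over ]s, tau0[ is at most 0 for every s in [0, tau0[
    (integral_weak_derivative_le0).  Morally it equals m tau0 - m s = - m s; since g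
    is only a weak derivative, this is seen by testing g against smooth plateaus
    which converge to the indicator function of ]s, tau0[, built from
    exp(-1/((x - a)(c - x))).

    A nonnegative nondecreasing weight is a positive superposition of indicator
    functions of intervals ending at tau0 (integral_nondecreasing_le0), hence the
    integral of k g is at most 0 as well.  This replaces an integration by parts. *)

(** * Negative binomial coefficients *)

(** The coefficient of z^n in (1 - z)^(-x), for an arbitrary real x. *)
Definition negbin {R : realType} (x : R) (n : nat) : R :=
  \prod_(i < n) ((x + i%:R) / i.+1%:R).

Lemma negbinS {R : realType} (x : R) n :
  negbin x n.+1 * n.+1%:R = (x + n%:R) * negbin x n.
Proof.
by rewrite /negbin big_ord_recr /= -mulrA divfK ?pnatr_eq0// mulrC.
Qed.

Lemma negbin0 {R : realType} (x : R) : negbin x 0 = 1.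
Proof. by rewrite /negbin big_ord0. Qed.

Lemma negbin_ge0 {R : realType} (x : R) n : 0 <= x -> 0 <= negbin x n.
Proof. by move=> x0; apply: prodr_ge0 => i _; rewrite divr_ge0// addr_ge0. Qed.

Lemma negbin_gt0 {R : realType} (x : R) n : 0 < x -> 0 < negbin x n.
Proof. by move=> x0; apply: prodr_gt0 => i _; rewrite divr_gt0// ltr_pwDl. Qed.

Lemma ler_negbin {R : realType} (x y : R) n :
  0 <= x -> x <= y -> negbin x n <= negbin y n.
Proof.
move=> x0 xy; apply: ler_prod => i _.
by rewrite divr_ge0 ?addr_ge0//= ler_pM2r ?invr_gt0// lerD2r.
Qed.

(** For 0 <= a <= 1 the power series (1 - z)^a is 1 minus a series with
    nonnegative coefficients; this sign is the reason why the recurrence for the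
    discrete resolvent below has nonnegative coefficients. *)
Lemma negbin_le0 {R : realType} (a : R) n : 0 <= a <= 1 -> negbin (- a) n.+1 <= 0.
Proof.
move=> /andP[a0 a1]; rewrite /negbin big_ord_recl /= addr0 divr1.
rewrite mulNr oppr_le0 mulr_ge0//; apply: prodr_ge0 => i _.
by rewrite divr_ge0// /= /bump add1n addrC subr_ge0 (le_trans a1)// ler1n.
Qed.

(** Chu-Vandermonde: compare coefficients in
    (1 - z)^(-x-y) = (1 - z)^(-x) (1 - z)^(-y).  The induction is the
    differential equation (1 - z) f' = x f read on coefficients: the factor
    n.+1 is distributed over each product as j + (n.+1 - j). *)
Lemma negbinD {R : realType} (x y : R) n :
  negbin (x + y) n = \sum_(j < n.+1) negbin x j * negbin y (n - j).
Proof.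
elim: n => [|n IHn]; first by rewrite big_ord_recl big_ord0 !negbin0 addr0 mulr1.
apply: (@mulIf _ n.+1%:R); first by rewrite pnatr_eq0.
rewrite negbinS IHn.
have E : (\sum_(j < n.+2) negbin x j * negbin y (n.+1 - j)) * n.+1%:R =
   \sum_(j < n.+2) (negbin x j * j%:R) * negbin y (n.+1 - j) +
   \sum_(j < n.+2) negbin x j * (negbin y (n.+1 - j) * (n.+1 - j)%:R).
  rewrite mulr_suml -big_split /=; apply: eq_bigr => j _.
  have jn : (j <= n.+1)%N by rewrite -ltnS.
  by rewrite natrB//; ring.
rewrite E [X in _ = X + _]big_ord_recl [X in _ = _ + X]big_ord_recr /= subnn.
rewrite !(mulr0, mul0r) addr0 add0r.
rewrite mulr_sumr -big_split /=; apply: eq_bigr => j _.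
have jn : (j <= n)%N by rewrite -ltnS.
rewrite /= /bump add1n subSS negbinS subSn// negbinS natrB//.
by ring.
Qed.

Lemma negbinSl {R : realType} (x : R) n :
  negbin x n.+1 * n.+1%:R = x * negbin (x + 1) n.
Proof.
rewrite negbinS.
elim: n => [|n IHn]; first by rewrite !negbin0 addr0.
have n0 : (n.+1%:R : R) != 0 by rewrite pnatr_eq0.
apply: (mulIf n0); rewrite -mulrA negbinS -[RHS]mulrA negbinS.
by rewrite IHn -[n.+1%:R]natr1; ring.
Qed.

Lemma negbin_pascal {R : realType} (x : R) n :
  negbin (x + 1) n.+1 = negbin x n.+1 + negbin (x + 1) n.
Proof.
have n0 : (n.+1%:R : R) != 0 by rewrite pnatr_eq0.
apply: (mulIf n0); rewrite mulrDl (negbinSl x) (negbinS (x + 1)) -[n.+1%:R]natr1.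
ring.
Qed.

(** The full sum over k is (1 - mu)^(-n-1); only the bound on partial sums is
    kept.  Multiplying by 1 - mu lowers n by one, by Pascal's rule. *)
Lemma negbin_partial_sum_le {R : realType} (mu : R) n K : 0 <= mu < 1 ->
  (1 - mu) ^+ n.+1 * \sum_(k < K) mu ^+ k * negbin (k%:R + 1) n <= 1.
Proof.
move=> /andP[mu0 mu1].
have T0 m L : 0 <= \sum_(k < L) mu ^+ k * negbin (k%:R + 1) m.
  by apply: sumr_ge0 => k _; rewrite mulr_ge0 ?exprn_ge0// negbin_ge0// addr_ge0.
elim: n K => [|n IHn] K.
  under eq_bigr do rewrite negbin0 mulr1.
  by rewrite expr1 -opprB mulNr -subrX1 opprB lerBlDr lerDl exprn_ge0.
apply: le_trans (IHn K).
rewrite exprSr -mulrA ler_wpM2l ?exprn_ge0 ?subr_ge0 ?(ltW mu1)//.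
case: K => [|K]; first by rewrite !big_ord0 mulr0.
have E : \sum_(k < K.+1) mu ^+ k * negbin (k%:R + 1) n.+1 =
   mu * (\sum_(k < K) mu ^+ k * negbin (k%:R + 1) n.+1) +
   \sum_(k < K.+1) mu ^+ k * negbin (k%:R + 1) n.
  transitivity (\sum_(k < K.+1) mu ^+ k * negbin (k%:R : R) n.+1 +
     \sum_(k < K.+1) mu ^+ k * negbin (k%:R + 1) n).
    by rewrite -big_split; apply: eq_bigr => k _; rewrite negbin_pascal mulrDr.
  congr (_ + _); rewrite big_ord_recl /= [X in _ * X + _](_ : _ = 0) ?mulr0 ?add0r.
    rewrite mulr_sumr; apply: eq_bigr => k _.
    by rewrite /= /bump add1n exprS mulrA -natr1.
  by rewrite /negbin big_ord_recl add0r mul0r mul0r.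
have H : \sum_(k < K) mu ^+ k * negbin (k%:R + 1) n.+1 <=
         \sum_(k < K.+1) mu ^+ k * negbin (k%:R + 1) n.+1.
  by rewrite big_ord_recr /= lerDl mulr_ge0 ?exprn_ge0// negbin_ge0// addr_ge0.
by rewrite mulrBl mul1r lerBlDr {1}E addrC lerD2l ler_wpM2l.
Qed.

Lemma is_cvg_series_negbin {R : realType} (mu : R) n : 0 <= mu < 1 ->
  cvgn (series (fun k => mu ^+ k * negbin (k%:R + 1) n)).
Proof.
move=> mu01; have /andP[mu0 mu1] := mu01.
apply: nondecreasing_is_cvgn.
  apply: nondecreasing_series => k _ _.
  by rewrite mulr_ge0 ?exprn_ge0// negbin_ge0// addr_ge0.
exists ((1 - mu) ^- n.+1) => _ [K _ <-].
rewrite -(ler_pM2l (_ : 0 < (1 - mu) ^+ n.+1)) ?exprn_gt0 ?subr_gt0//.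
rewrite divff ?expf_neq0 ?subr_eq0 ?gt_eqF//.
by rewrite /series /= big_mkord; exact: negbin_partial_sum_le.
Qed.

(** * The discrete resolvent *)

(** Expanding in powers of mu, the sum over k of these terms is the coefficient of
    z^n in 1 / ((1 - z) (1 + mu (1 - z)^(-a))).  This is the implicit Euler
    scheme, with mu = lambda h^a, for the fractional relaxation equation whose
    solution is t |-> E_a(- lambda t^a). *)
Definition resolvent_term {R : realType} (a mu : R) n k : R :=
  (- mu) ^+ k * negbin (k%:R * a + 1) n.

Definition resolvent_coef {R : realType} (a mu : R) n : R :=
  limn (series (resolvent_term a mu n)).

Lemma is_cvg_series_negbin_affine {R : realType} (a mu : R) n :
  0 < a <= 1 -> 0 <= mu < 1 ->
  cvgn (series (fun k => mu ^+ k * negbin (k%:R * a + 1) n)).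
Proof.
move=> /andP[/ltW a0 a1] mu01; have /andP[mu0 mu1] := mu01.
have t0 k : 0 <= k%:R * a + 1 by rewrite addr_ge0// mulr_ge0.
apply: series_le_cvg (is_cvg_series_negbin mu n mu01) => k.
- by rewrite mulr_ge0 ?exprn_ge0 ?negbin_ge0.
- by rewrite mulr_ge0 ?exprn_ge0// negbin_ge0// addr_ge0.
- by rewrite ler_wpM2l ?exprn_ge0// ler_negbin// lerD2r ler_piMr.
Qed.

Lemma norm_resolvent_term {R : realType} (a mu : R) n k : 0 <= a -> 0 <= mu ->
  `|resolvent_term a mu n k| = mu ^+ k * negbin (k%:R * a + 1) n.
Proof.
move=> a0 mu0; rewrite normrM normrX normrN (ger0_norm mu0) ger0_norm//.
by rewrite negbin_ge0// addr_ge0// mulr_ge0.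
Qed.

Lemma is_cvg_resolvent {R : realType} (a mu : R) n : 0 < a <= 1 -> 0 <= mu < 1 ->
  cvgn (series (resolvent_term a mu n)).
Proof.
move=> a01 mu01; have /andP[a0 _] := a01; have /andP[mu0 _] := mu01.
apply: normed_cvg; rewrite (_ : [normed _] = series (fun k => mu ^+ k * negbin (k%:R * a + 1) n)).
  exact: is_cvg_series_negbin_affine.
by apply/funext => K; apply: eq_bigr => k _ /=; rewrite norm_resolvent_term// ltW.
Qed.

(** The identity ((1 - z)^a + mu) D(z) = (1 - z)^(a-1) for the generating function
    D of the coefficients, read on the coefficient of z^n.  It is proved on partial
    sums over k, where convolving with (1 - z)^a turns the term k into the term
    k - 1 up to the factor - mu; hence the shift K.+1 against K. *)
Lemma resolvent_coef_rec {R : realType} (a mu : R) n : 0 < a <= 1 -> 0 <= mu < 1 ->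
  (1 + mu) * resolvent_coef a mu n =
  negbin (1 - a) n +
  \sum_(j < n) (- negbin (- a) j.+1) * resolvent_coef a mu (n - j.+1).
Proof.
move=> a01 mu01.
have cv m := is_cvg_resolvent a mu m a01 mu01.
have cvS m : series (resolvent_term a mu m) K.+1 @[K --> \oo] --> resolvent_coef a mu m.
  by rewrite (cvg_shiftS (series (resolvent_term a mu m))); exact: cv.
have L : \sum_(j < n.+1) negbin (- a) j * series (resolvent_term a mu (n - j)) K.+1
   @[K --> \oo] --> \sum_(j < n.+1) negbin (- a) j * resolvent_coef a mu (n - j).
  apply: cvg_big => [|j _]; first exact: add_continuous.
  apply: cvgM; [exact: cvg_cst|exact: cvS].
have M : negbin (1 - a) n - mu * series (resolvent_term a mu n) K @[K --> \oo]
    --> negbin (1 - a) n - mu * resolvent_coef a mu n.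
  by apply: cvgB; [exact: cvg_cst|apply: cvgM; [exact: cvg_cst|exact: cv]].
have E : (fun K => \sum_(j < n.+1) negbin (- a) j * series (resolvent_term a mu (n - j)) K.+1)
  = (fun K => negbin (1 - a) n - mu * series (resolvent_term a mu n) K).
  apply/funext => K; rewrite /series /=.
  under eq_bigr do rewrite big_mkord mulr_sumr.
  rewrite exchange_big /= big_ord_recl /= /resolvent_term.
  congr (_ + _).
    under eq_bigr do rewrite expr0 mul1r.
    by rewrite -(negbinD (- a)) mul0r add0r addrC.
  rewrite big_mkord mulr_sumr -sumrN; apply: eq_bigr => k _.
  under eq_bigr do rewrite mulrCA.
  rewrite -mulr_sumr -(negbinD (- a)) /bump add1n exprS !mulNr mulrA.
  by congr (- (_ * negbin _ _)); rewrite -natr1; ring.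
move: L; rewrite E => L; have := @cvg_unique _ (@Rhausdorff R) _ _ _ _ L M => /(_ _).
rewrite big_ord_recl negbin0 mul1r subn0 => H.
under eq_bigr do rewrite mulNr.
rewrite sumrN.
have <- : \sum_(j < n) negbin (- a) (bump 0 j) * resolvent_coef a mu (n - bump 0 j) =
  \sum_(j < n) negbin (- a) j.+1 * resolvent_coef a mu (n - j.+1) by [].
by move: H; rewrite /=; set S := \sum_(_ < n) _; lra.
Qed.

(** In the recurrence every coefficient is nonnegative, so that nonnegativity and
    monotonicity in mu propagate from the smaller indices. *)
Lemma resolvent_coef_bounds {R : realType} (a mu nu : R) n :
  0 < a <= 1 -> 0 <= mu -> mu <= nu -> nu < 1 ->
  0 <= resolvent_coef a nu n <= resolvent_coef a mu n.
Proof.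
move=> a01 mu0 munu nu1; have /andP[a0 a1] := a01.
have nu0 : 0 <= nu := le_trans mu0 munu.
have mu01 : 0 <= mu < 1 by rewrite mu0 (le_lt_trans munu).
have nu01 : 0 <= nu < 1 by rewrite nu0.
elim/ltn_ind: n => n IHn.
have b0 j : 0 <= - negbin (- a) j.+1 by rewrite oppr_ge0 negbin_le0// ltW.
have IH (j : 'I_n) : 0 <= resolvent_coef a nu (n - j.+1) <= resolvent_coef a mu (n - j.+1).
  by apply: IHn; rewrite ltn_subrL/= (leq_ltn_trans (leq0n j)).
have en0 : 0 <= resolvent_coef a nu n.
  have nu1_gt0 : 0 < 1 + nu by rewrite ltr_pwDl.
  rewrite -(pmulr_rge0 _ nu1_gt0) resolvent_coef_rec// addr_ge0//.
    by rewrite negbin_ge0// subr_ge0.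
  by apply: sumr_ge0 => j _; rewrite mulr_ge0//; case/andP: (IH j).
rewrite en0 /=; have mu1_gt0 : 0 < 1 + mu by rewrite ltr_pwDl.
rewrite -(ler_pM2l mu1_gt0); apply: (@le_trans _ _ ((1 + nu) * resolvent_coef a nu n)).
  by rewrite ler_wpM2r// lerD2l.
rewrite !resolvent_coef_rec// lerD2l; apply: ler_sum => j _.
by rewrite ler_wpM2l//; case/andP: (IH j).
Qed.

(** * Euler's integral over a finite interval *)

Lemma within_continuous_powR {R : realType} (x N : R) : 0 <= x -> 0 < N ->
  {within `[0, N], continuous (fun t : R => t `^ x)}.
Proof.
move=> x0 N0; have [->|xn0] := eqVneq x 0.
  rewrite (_ : (fun t : R => t `^ 0) = cst 1).
    by apply: continuous_subspaceT => ?; exact: cvg_cst.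
  by apply/funext => t; rewrite powRr0.
have xgt0 : 0 < x by rewrite lt_neqAle eq_sym xn0.
have c (t : R) : 0 < t -> {for t, continuous (fun t : R => t `^ x)}.
  move=> t0; apply: differentiable_continuous; apply/derivable1_diffP.
  by apply: derivable_powR; rewrite in_itv/= t0.
apply/continuous_within_itvP => //; split.
- by move=> t; rewrite in_itv/= => /andP[t0 _]; exact: c.
- by rewrite powR0//; exact: powR_cvg0.
- by apply: cvg_at_left_filter; exact: c.
Qed.

Lemma is_derive_linX {R : realType} (N t : R) j :
  is_derive t 1 (fun t : R => (1 - t / N) ^+ j.+1) (- (j.+1%:R / N) * (1 - t / N) ^+ j).
Proof.
have -> : (fun t : R => (1 - t / N) ^+ j.+1) = horner ((1 - N^-1 *: 'X) ^+ j.+1).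
  by apply/funext => u; rewrite !hornerE mulrC.
apply: (is_derive_eq (is_derive_poly _ t)).
rewrite deriv_exp derivB derivC derivZ derivX /= hornerMn !hornerE.
by rewrite -mulr_natl [t / N]mulrC; ring.
Qed.

Lemma continuous_linX {R : realType} (N : R) j : continuous (fun t : R => (1 - t / N) ^+ j).
Proof.
have -> : (fun t : R => (1 - t / N) ^+ j) = horner ((1 - N^-1 *: 'X) ^+ j).
  by apply/funext => u; rewrite !hornerE mulrC.
exact: continuous_horner.
Qed.

Lemma within_continuousM {R : realType} (A : set R) (f g : R -> R) :
  {within A, continuous f} -> {within A, continuous g} ->
  {within A, continuous (fun t => f t * g t)}.
Proof. by move=> cf cg t; apply: cvgM; [exact: cf|exact: cg]. Qed.

Lemma within_continuous_powR_linX {R : realType} (x N : R) j : 0 <= x -> 0 < N ->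
  {within `[0, N], continuous (fun t : R => t `^ x * (1 - t / N) ^+ j)}.
Proof.
move=> x0 N0; apply: within_continuousM; first exact: within_continuous_powR.
by apply: continuous_subspaceT; exact: continuous_linX.
Qed.

Lemma integrable_powR_linX {R : realType} (x N : R) j : 0 <= x -> 0 < N ->
  lebesgue_measure.-integrable `[0, N] (EFin \o (fun t : R => t `^ x * (1 - t / N) ^+ j)).
Proof.
move=> x0 N0; apply: continuous_compact_integrable; first exact: segment_compact.
exact: within_continuous_powR_linX.
Qed.

(** Integration by parts: t^(x+1) (1 - t/N)^(j+1) vanishes at both ends. *)
Lemma euler_integral_rec {R : realType} (x N : R) j : 0 <= x -> 0 < N ->
  (x + 1) * \int[lebesgue_measure]_(t in `[0, N]) (t `^ x * (1 - t / N) ^+ j.+1) =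
  j.+1%:R / N * \int[lebesgue_measure]_(t in `[0, N]) (t `^ (x + 1) * (1 - t / N) ^+ j).
Proof.
move=> x0 N0.
have x10 : 0 <= x + 1 by rewrite addr_ge0.
have i1 := integrable_powR_linX x N j.+1 x0 N0.
have i2 := integrable_powR_linX (x + 1) N j x10 N0.
have i3 : lebesgue_measure.-integrable `[0, N]
  (EFin \o (fun t : R => (x + 1) * (t `^ x * (1 - t / N) ^+ j.+1))).
  by apply: (integrableZl _ _ i1).
have i4 : lebesgue_measure.-integrable `[0, N]
  (EFin \o (fun t : R => j.+1%:R / N * (t `^ (x + 1) * (1 - t / N) ^+ j))).
  by apply: (integrableZl _ _ i2).
rewrite -!RintegralZl//; apply/eqP; rewrite -subr_eq0 -RintegralB//; apply/eqP.
rewrite /Rintegral.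
rewrite (@continuous_FTC2 _ _ (fun t : R => t `^ (x + 1) * (1 - t / N) ^+ j.+1))//=.
- by rewrite divff ?gt_eqF// subrr expr0n/= mulr0 powR0 ?mul0r ?subrr// gt_eqF// ltr_wpDl.
- apply: within_continuousB; apply: within_continuousM.
  + by apply: continuous_subspaceT; exact: cst_continuous.
  + exact: within_continuous_powR_linX.
  + by apply: continuous_subspaceT; exact: cst_continuous.
  + exact: within_continuous_powR_linX.
- have cw := within_continuous_powR_linX (x + 1) N j.+1 x10 N0.
  split.
  + move=> t; rewrite in_itv/= => /andP[t0 _].
    apply: derivableM; first by apply: derivable_powR; rewrite in_itv/= t0.
    by have [] := is_derive_linX N t j.
  + by have [] := (continuous_within_itvP _ N0).1 cw.
  + by have [] := (continuous_within_itvP _ N0).1 cw.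
- move=> t; rewrite in_itv/= => /andP[t0 _].
  rewrite derive1E.
  have := @is_derive1_powR R (x + 1) t t0; rewrite addrK => D1.
  have D2 := is_derive_linX N t j.
  rewrite deriveM//; [|exact: ex_derive..].
  rewrite !derive_val /GRing.scale/=; ring.
Qed.

(** The right-hand side is N^(x+1) B(x + 1, j + 1), for the Beta function B. *)
Lemma euler_integralE {R : realType} (x N : R) j : 0 <= x -> 0 < N ->
  \int[lebesgue_measure]_(t in `[0, N]) (t `^ x * (1 - t / N) ^+ j) =
  N `^ (x + 1) / ((x + j%:R + 1) * negbin (x + 1) j).
Proof.
move=> + N0; elim: j x => [|j IHj] x x0.
  rewrite negbin0 addr0 mulr1.
  rewrite /Rintegral (@continuous_FTC2 _ _ (fun t : R => (x + 1)^-1 * t `^ (x + 1)))//=.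
  - by rewrite powR0 ?mulr0 ?subr0 1?mulrC// gt_eqF// ltr_wpDl.
  - rewrite (_ : (fun _ => _) = (fun t : R => t `^ x)).
      exact: within_continuous_powR.
    by apply/funext => t; rewrite expr0 mulr1.
  - have cw : {within `[0, N], continuous (fun t : R => (x + 1)^-1 * t `^ (x + 1))}.
      apply: within_continuousM; last by apply: within_continuous_powR => //; rewrite addr_ge0.
      by apply: continuous_subspaceT; exact: cst_continuous.
    split.
    + move=> t; rewrite in_itv/= => /andP[t0 _].
      by apply: derivableM => //; apply: derivable_powR; rewrite in_itv/= t0.
    + by have [] := (continuous_within_itvP _ N0).1 cw.
    + by have [] := (continuous_within_itvP _ N0).1 cw.
  - move=> t; rewrite in_itv/= => /andP[t0 _].
    rewrite derive1E expr0 mulr1.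
    have := @is_derive1_powR R (x + 1) t t0; rewrite addrK => D1.
    rewrite deriveM//.
    rewrite !derive_val /GRing.scale/= mulr0 addr0 mulrA mulVf ?mul1r//.
    by rewrite gt_eqF// ltr_wpDl.
have x10 : 0 < x + 1 by rewrite ltr_wpDl.
apply: (@mulfI _ (x + 1)); first by rewrite gt_eqF.
rewrite euler_integral_rec// IHj ?addr_ge0//.
have E := negbinSl (x + 1) j.
have P2 : negbin (x + 1 + 1) j != 0 by rewrite gt_eqF// negbin_gt0// ltr_wpDl// ltW.
rewrite powRD; last by rewrite (gt_eqF N0) implybT.
rewrite powRr1 ?ltW//.
have Q : x + j.+1%:R + 1 != 0 by rewrite gt_eqF// ltr_wpDl// addr_ge0.
rewrite -[j.+1%:R]natr1 in E Q *.
have J : j%:R + 1 != 0 :> R by rewrite natr1 pnatr_eq0.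
rewrite (_ : negbin (x + 1) j.+1 = (x + 1) * negbin (x + 1 + 1) j / (j%:R + 1)); last first.
  by rewrite -E mulfK.
field.
by rewrite J (gt_eqF N0) (gt_eqF x10) P2 Q.
Qed.

(** * The compound-interest approximation of the exponential *)

Lemma bernoulli_ineq {R : realType} (d : R) n : -1 <= d -> 1 + n%:R * d <= (1 + d) ^+ n.
Proof.
move=> d1; have d0 : 0 <= 1 + d by lra.
elim: n => [|n IHn]; first by rewrite mul0r addr0 expr0.
rewrite exprS; apply: (le_trans _ (ler_wpM2l d0 IHn)).
have : 0 <= n%:R * d ^+ 2 by rewrite mulr_ge0// sqr_ge0.
rewrite -[n.+1%:R]natr1; move: (n%:R : R) => m; nra.
Qed.

(** Bernoulli's inequality applied to the ratio of the two bases. *)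
Lemma compound_nondecreasing {R : realType} (t : R) n : 0 <= t -> t <= n.+1%:R ->
  (1 - t / n.+1%:R) ^+ n.+1 <= (1 - t / n.+2%:R) ^+ n.+2.
Proof.
move=> t0 tn.
have n1 : (0 : R) < n.+1%:R by [].
have n2 : (0 : R) < n.+2%:R by [].
have E : n.+2%:R = n.+1%:R + 1 :> R by rewrite natr1.
set y := 1 - t / n.+1%:R; set z := 1 - t / n.+2%:R.
have y0 : 0 <= y by rewrite subr_ge0 ler_pdivrMr// mul1r.
have yz : y <= z.
  by rewrite lerD2l lerN2 ler_wpM2l// lef_pV2 ?posrE// ler_nat.
have [y00|yn0] := eqVneq y 0; first by rewrite y00 expr0n/= exprn_ge0// (le_trans y0).
have {yn0}yp : 0 < y by rewrite lt_neqAle eq_sym yn0.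
have F : n.+2%:R * (z - y) = 1 - y.
  rewrite /z /y E; have : n.+1%:R != 0 :> R by rewrite gt_eqF.
  have : n.+1%:R + 1 != 0 :> R by rewrite -E gt_eqF.
  by move: (n.+1%:R : R) => m m1 m0; field; rewrite m0 m1.
have := @bernoulli_ineq R ((z - y) / y) n.+2.
have -> : 1 + (z - y) / y = z / y by field; rewrite gt_eqF.
rewrite mulrA F expr_div_n [y ^+ n.+2]exprS.
have -> : 1 + (1 - y) / y = y^-1 by field; rewrite gt_eqF.
have d0 : -1 <= (z - y) / y.
  by apply: (@le_trans _ _ 0); [lra|rewrite divr_ge0// subr_ge0].
move=> /(_ d0); rewrite invfM mulrCA ler_pMr ?invr_gt0//.
by rewrite ler_pdivlMr ?exprn_gt0// mul1r.
Qed.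

Lemma compound_le_exp {R : realType} (t : R) n : 0 <= t -> t <= n.+1%:R ->
  (1 - t / n.+1%:R) ^+ n.+1 <= expR (- t).
Proof.
move=> t0 tn.
have -> : - t = (- (t / n.+1%:R)) * n.+1%:R by rewrite mulNr divfK.
rewrite expRM_natr lerXn2r// ?nnegrE ?expR_ge0//.
  by rewrite subr_ge0 ler_pdivrMr// mul1r.
exact: expR_ge1Dx.
Qed.

(** Since (1 - u) e^u >= (1 - u) (1 + u) = 1 - u^2 for u = t / n.+1, raising to the
    power n.+1 and applying Bernoulli's inequality loses only t^2 / n.+1. *)
Lemma compound_ge_exp {R : realType} (t : R) n : 0 <= t -> t <= n.+1%:R ->
  expR (- t) * (1 - t ^+ 2 / n.+1%:R) <= (1 - t / n.+1%:R) ^+ n.+1.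
Proof.
move=> t0 tn.
set u := t / n.+1%:R.
have u0 : 0 <= u by rewrite divr_ge0.
have u1 : u <= 1 by rewrite ler_pdivrMr// mul1r.
have E : t = u * n.+1%:R by rewrite divfK.
rewrite mulrC -ler_pdivlMr ?expR_gt0// -expRN opprK {2}E expRM_natr -exprMn.
apply: (@le_trans _ _ ((1 + - u ^+ 2) ^+ n.+1)).
  apply: le_trans (bernoulli_ineq _ _ _); last first.
    by rewrite lerN2 exprn_ile1.
  rewrite lerD2l mulrN lerN2 /u; have n0 : n.+1%:R != 0 :> R by rewrite pnatr_eq0.
  by rewrite le_eqVlt; apply/orP; left; apply/eqP; field; rewrite addrC natr1.
rewrite lerXn2r// ?nnegrE.
- by rewrite subr_ge0 exprn_ile1.
- by rewrite mulr_ge0 ?subr_ge0 ?expR_ge0.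
- have : (1 - u) * (1 + u) <= (1 - u) * expR u.
    by rewrite ler_wpM2l ?subr_ge0 ?expR_ge1Dx.
  by apply: le_trans; rewrite le_eqVlt; apply/orP; left; apply/eqP; ring.
Qed.

Lemma cvg_compound {R : realType} (t : R) : 0 <= t ->
  (if t <= n.+1%:R then (1 - t / n.+1%:R) ^+ n.+1 else 0) @[n --> \oo] --> expR (- t).
Proof.
move=> t0.
have near_t : \forall n \near \oo, t <= n.+1%:R.
  near=> n; rewrite (@le_trans _ _ n%:R) ?ler_nat//; near: n; exact: nbhs_infty_ger.
apply: (@squeeze_cvgr _ _ _ _ (fun n => expR (- t) * (1 - t ^+ 2 * n.+1%:R^-1)) (fun=> expR (- t))).
- near=> n; have tn : t <= n.+1%:R by near: n.
  by rewrite tn compound_ge_exp//= compound_le_exp.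
- suff : expR (- t) * (1 - t ^+ 2 * n.+1%:R^-1) @[n --> \oo] -->
      expR (- t) * (1 - t ^+ 2 * 0) by rewrite mulr0 subr0 mulr1.
  apply: cvgM; first exact: cvg_cst.
  apply: cvgB; first exact: cvg_cst.
  by apply: cvgM; [exact: cvg_cst|exact: cvg_harmonic].
- exact: cvg_cst.
Unshelve. all: by end_near. Qed.

(** * Gauss's limit formula for the Gamma function *)

(** Gauss's approximation of 1 / Gamma (x + 1). *)
Definition gauss_ratio {R : realType} (x : R) n : R := negbin (x + 1) n / n%:R `^ x.

Lemma gauss_ratio_gt0 {R : realType} (x : R) n : 0 <= x -> 0 < gauss_ratio x n.+1.
Proof.
by move=> x0; rewrite divr_gt0 ?powR_gt0// negbin_gt0// ltr_wpDl.
Qed.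

(** The quotient of consecutive terms is (1 + x/(k+2)) ((k+1)/(k+2))^x, which is at
    most 1 because 1 + x/(k+2) <= e^(x/(k+2)) and e^(1/(k+2)) <= (k+2)/(k+1).
    Monotonicity in n, uniformly in x, is what provides a dominating series when
    n tends to infinity in the series over x = k a. *)
Lemma gauss_ratio_nonincreasing {R : realType} (x : R) m n : 0 <= x -> (m <= n)%N ->
  gauss_ratio x n.+1 <= gauss_ratio x m.+1.
Proof.
move=> x0.
have S k : gauss_ratio x k.+2 <= gauss_ratio x k.+1.
  have k1 : (0 : R) < k.+1%:R by [].
  have k2 : (0 : R) < k.+2%:R by [].
  have E : negbin (x + 1) k.+2 = negbin (x + 1) k.+1 * (1 + x / k.+2%:R).
    apply: (@mulIf _ k.+2%:R); first by rewrite pnatr_eq0.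
    rewrite negbinS mulrC -mulrA; congr (_ * _).
    by rewrite mulrDl mul1r divfK ?gt_eqF// -[k.+2%:R]natr1; ring.
  rewrite /gauss_ratio ler_pdivrMr ?powR_gt0// mulrAC ler_pdivlMr ?powR_gt0// E.
  rewrite -mulrA ler_wpM2l//; first by rewrite negbin_ge0// addr_ge0.
  have -> : k.+2%:R = k.+2%:R / k.+1%:R * k.+1%:R :> R by rewrite divfK// gt_eqF.
  rewrite powRM ?divr_ge0// ler_wpM2r ?powR_ge0// divfK ?gt_eqF//.
  apply: (le_trans (expR_ge1Dx _)); rewrite mulrC expRM.
  rewrite ge0_ler_powR// ?nnegrE ?expR_ge0 ?divr_ge0//.
  rewrite -[leRHS]invrK -lef_pV2 ?posrE ?expR_gt0 ?invr_gt0 ?divr_gt0//.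
  rewrite invrK -expRN invf_div.
  apply: le_trans (expR_ge1Dx _).
  rewrite le_eqVlt; apply/orP; left; apply/eqP.
  rewrite -[k.+2%:R]natr1; move: (k.+1%:R : R) k1 => p p0.
  by field; rewrite gt_eqF// addr_gt0.
elim: n => [|n IHn]; first by rewrite leqn0 => /eqP ->.
rewrite leq_eqVlt => /predU1P[->//|mn].
exact: le_trans (S n) (IHn mn).
Qed.

(** Monotone convergence, the integrands being extended by 0 beyond n.+1. *)
Lemma cvg_euler_integral {R : realType} (x : R) : 0 <= x ->
  (\int[lebesgue_measure]_(t in `[0%R, n.+1%:R]) (t `^ x * (1 - t / n.+1%:R) ^+ n.+1)%R%:E)%E
   @[n --> \oo] --> (\int[lebesgue_measure]_(t in `]0%R, +oo[) (t `^ x * expR (- t))%R%:E)%E.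
Proof.
move=> x0.
pose h n (t : R) := t `^ x * (1 - t / n.+1%:R) ^+ n.+1.
pose g n (t : R) : \bar R := ((EFin \o h n) \_ `]-oo, n.+1%:R]) t.
have mh n : measurable_fun setT (h n).
  apply: measurable_funM; first exact: measurable_powR.
  by apply: continuous_measurable_fun; exact: continuous_linX.
have gE n t : g n t = (if t <= n.+1%:R then h n t else 0)%:E.
  rewrite /g patchE; case: ifPn; case: ifPn => //=.
    by move=> /negP + /set_mem/=; rewrite in_itv.
  by move=> tn /negP; rewrite inE/= in_itv/= tn.
have D : forall n, (\int[lebesgue_measure]_(t in `[0%R, n.+1%:R]) (h n t)%:E =
    \int[lebesgue_measure]_(t in `]0%R, +oo[) g n t)%E.
  move=> n; rewrite -integral_itv_obnd_cbnd; last first.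
    by apply/measurable_EFinP; exact: measurable_funTS.
  rewrite -integral_mkcondr; congr (integral _ _ _).
  by apply/seteqP; split => t /=; rewrite !in_itv/= andbT; [move/andP|move=> [-> ->]].
rewrite (_ : (fun n => _) =
    (fun n => \int[lebesgue_measure]_(t in `]0%R, +oo[) g n t)%E); last first.
  by apply/funext => n; rewrite -D.
have glim t : 0 <= t -> g n t @[n --> \oo] --> (t `^ x * expR (- t))%:E.
  move=> t0; rewrite (_ : (fun n => g n t) = EFin \o (fun n : nat =>
      t `^ x * (if t <= n.+1%:R then (1 - t / n.+1%:R) ^+ n.+1 else 0))).
    apply: cvg_EFin; first exact: nearW.
    by apply: cvgM; [exact: cvg_cst|exact: cvg_compound].
  by apply/funext => n; rewrite gE /h /=; case: ifP => //; rewrite mulr0.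
have -> : (\int[lebesgue_measure]_(t in `]0%R, +oo[) (t `^ x * expR (- t))%:E)%E =
    (\int[lebesgue_measure]_(t in `]0%R, +oo[) limn (g^~ t))%E.
  apply: eq_integral => t; rewrite inE/= in_itv/= andbT => t0.
  by apply/esym/cvg_lim => //; apply: glim; exact: ltW.
apply: cvg_monotone_convergence => //.
- move=> n; rewrite /g; apply: measurable_funTS; apply/(measurable_restrictT _ _).1 => //.
  apply/measurable_EFinP; exact: (measurable_funTS (mh n)).
- move=> n t; rewrite /= in_itv/= andbT => t0; rewrite gE lee_fin; case: ifP => // tn.
  by rewrite mulr_ge0 ?powR_ge0// exprn_ge0// subr_ge0 ler_pdivrMr// mul1r.
- move=> t; rewrite /= in_itv/= andbT => t0.
  apply/nondecreasing_seqP => n; rewrite !gE lee_fin.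
  case: ifPn => tn; last first.
    case: ifPn => // tn1.
    by rewrite mulr_ge0 ?powR_ge0// exprn_ge0// subr_ge0 ler_pdivrMr// mul1r.
  rewrite (le_trans tn) ?ler_nat// ler_wpM2l ?powR_ge0//.
  by rewrite compound_nondecreasing// ltW.
Qed.

(** By the closed form of the finite Euler integral J n, the ratio is c n / J n with
    c n -> 1, and J n tends to the integral defining Gamma (x + 1) in the extended
    reals.  Were that integral infinite, both sides would still agree: the ratio would
    tend to 0, and the convention gives the real value 0 to +oo and the inverse 0
    to 0; so its finiteness need not be decided. *)
Lemma cvg_gauss_ratio {R : realType} (x : R) : 0 <= x ->
  gauss_ratio x n.+1 @[n --> \oo] --> (Gamma (x + 1))^-1.
Proof.
move=> x0; rewrite /Gamma /Rintegral addrK.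
set G := (\int[_]_(_ in _) _)%E.
pose c (n : nat) : R := n.+1%:R / (x + n.+1%:R + 1).
pose J (n : nat) : R := c n / gauss_ratio x n.+1.
have cpos n : 0 < c n by rewrite divr_gt0// ltr_wpDl// addr_ge0.
have c1 : c n @[n --> \oo] --> (1 : R).
  apply: (@squeeze_cvgr _ _ _ _ (fun n => 1 - (x + 1) * n.+1%:R^-1) (fun=> 1)).
  - apply: nearW => n; have N0 : (0 : R) < n.+1%:R by [].
    have -> : c n = 1 - (x + 1) / (x + n.+1%:R + 1).
      rewrite /c; move: (n.+1%:R : R) N0 => N N0.
      by field; rewrite gt_eqF// ltr_wpDl// addr_ge0// ltW.
    rewrite lerD2l lerN2 ler_wpM2l ?addr_ge0//=; last first.
      by rewrite lef_pV2 ?posrE//; [rewrite addrAC lerDr addr_ge0|rewrite ltr_wpDl// addr_ge0].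
    by rewrite lerBlDr lerDl divr_ge0 ?addr_ge0.
  - suff : 1 - (x + 1) * n.+1%:R^-1 @[n --> \oo] --> 1 - (x + 1) * 0 by rewrite mulr0 subr0.
    apply: cvgB; first exact: cvg_cst.
    by apply: cvgM; [exact: cvg_cst|exact: cvg_harmonic].
  - exact: cvg_cst.
have Jpos n : 0 < J n by rewrite divr_gt0// gauss_ratio_gt0.
have JG : (J n)%:E @[n --> \oo] --> G.
  have := cvg_euler_integral x x0; rewrite -/G; apply: cvg_trans.
  apply: near_eq_cvg; apply: nearW => n.
  have := congr1 EFin (euler_integralE x n.+1%:R n.+1 x0 (ltr0Sn _ _)).
  rewrite /Rintegral fineK.
    move=> ->; congr EFin; rewrite /J /c /gauss_ratio.
    rewrite powRD; last by rewrite pnatr_eq0 implybT.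
    rewrite powRr1//.
    have g0 : negbin (x + 1) n.+1 != 0 by rewrite gt_eqF// negbin_gt0// ltr_wpDl.
    have p0 : n.+1%:R `^ x != 0 by rewrite gt_eqF// powR_gt0.
    have N0 : (0 : R) < n.+1%:R by [].
    move: (n.+1%:R : R) N0 p0 g0 => N N0 p0 g0; field.
    by rewrite p0 g0 gt_eqF// ltr_wpDl// addr_ge0// ltW.
  apply: integrable_fin_num => //.
  exact: integrable_powR_linX.
have E : (fun n => gauss_ratio x n.+1) = (fun n => c n * (J n)^-1).
  apply/funext => n; rewrite /J invf_div mulrCA divff ?mulr1// gt_eqF//.
rewrite E.
have G0 : (0 <= G)%E.
  by apply: integral_ge0 => t _; rewrite lee_fin mulr_ge0 ?powR_ge0 ?expR_ge0.
case: G JG G0 => [r| |] // JG _ /=.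
  (* the limit is positive since J is bounded below by a positive constant *)
  rewrite -[r^-1]mul1r; apply: cvgM => //.
  have Jr : J n @[n --> \oo] --> r by have := fine_cvg JG; apply.
  apply: cvgV => //; rewrite gt_eqF//.
  have a0 := gauss_ratio_gt0 x 0 x0.
  have c0 := cpos 0.
  apply: (@lt_le_trans _ _ (c 0 / gauss_ratio x 1)); first by rewrite divr_gt0.
  apply: (cvgr_to_ge Jr); apply: nearW => n.
  apply: ler_pM; rewrite ?invr_ge0 ?(ltW a0) ?(ltW c0)//.
    rewrite /c ler_pdivrMr ?ltr_wpDl ?addr_ge0// mulrAC ler_pdivlMr ?ltr_wpDl ?addr_ge0//.
    have : (1 : R) <= n.+1%:R by rewrite ler1n.
    by move: (n.+1%:R : R) => N; nra.
  by rewrite lef_pV2 ?posrE ?gauss_ratio_gt0// gauss_ratio_nonincreasing.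
rewrite invr0; suff : c n * (J n)^-1 @[n --> \oo] --> (1 * 0 : R) by rewrite mulr0.
apply: cvgM => //; apply/gtr0_cvgV0; first exact: nearW.
exact/cvgeryP.
Qed.

(** * Positivity and monotonicity of the Mittag-Leffler function *)

Lemma series_tail_le {R : realType} (f M : nat -> R) K :
  (forall k, `|f k| <= M k) -> cvgn (series M) ->
  `|limn (series f) - series f K| <= limn (series M) - series M K.
Proof.
move=> fM cM.
have cf : cvgn (series f).
  apply: normed_cvg; apply: (series_le_cvg _ _ _ cM) => k //=.
  exact: le_trans (fM k).
have M0 k : 0 <= M k by exact: le_trans (fM k).
have H : `|series f L - series f K| @[L --> \oo] --> `|limn (series f) - series f K|.
  by apply: cvg_norm; apply: cvgB; [exact: cf|exact: cvg_cst].
apply: (cvgr_to_le H); exists K => // L /= KL.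
rewrite sub_series_geq//; apply: (le_trans (ler_norm_sum _ _ _)).
apply: (@le_trans _ _ (series M L - series M K)).
  by rewrite sub_series_geq//; apply: ler_sum => k _; exact: fM.
rewrite lerD2r; apply: nondecreasing_cvgn_le => //.
by apply: nondecreasing_series => k _ _; exact: M0.
Qed.

(** Tannery's theorem: dominated convergence for series.  The sums are split at a
    rank after which the tail of the dominating series is small. *)
Lemma cvg_limn_series {R : realType} (f : nat -> nat -> R) (F M : nat -> R) (n0 : nat) :
  (forall n k, (n0 <= n)%N -> `|f n k| <= M k) -> cvgn (series M) ->
  (forall k, f n k @[n --> \oo] --> F k) ->
  limn (series (f n)) @[n --> \oo] --> limn (series F).
Proof.
move=> fM cM fF.
have FM k : `|F k| <= M k.
  apply: (cvgr_to_le (cvg_norm (fF k))); exists n0 => // n /= n0n; exact: fM.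
apply/cvgrPdist_le => e e0.
have e3 : 0 < e / 3 by rewrite divr_gt0.
have [K _ KM] : \forall K \near \oo, limn (series M) - series M K <= e / 3.
  have /cvgrPdist_le/(_ _ e3) := cM; apply: filterS => K.
  exact: le_trans (ler_norm _).
have {}KM : limn (series M) - series M K <= e / 3 by apply: KM => /=.
have SK : series (f n) K @[n --> \oo] --> series F K.
  apply: cvg_big => [|k _]; first exact: add_continuous.
  exact: fF.
have /cvgrPdist_le/(_ _ e3) SK3 := SK.
near=> n.
have nn0 : (n0 <= n)%N by near: n; exists n0.
have h1 := series_tail_le _ _ K FM cM.
have h2 := series_tail_le _ _ K (fM n ^~ nn0) cM.
have h3 : `|series F K - series (f n) K| <= e / 3 by near: n.
rewrite (_ : _ - _ = (limn (series F) - series F K) + (series F K - series (f n) K)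
  - (limn (series (f n)) - series (f n) K)); last by ring.
have -> : e = e / 3 + e / 3 + e / 3 by field.
apply: (le_trans (ler_normB _ _)); apply: lerD; last exact: le_trans KM.
by apply: (le_trans (ler_normD _ _)); apply: lerD => //; exact: le_trans KM.
Unshelve. all: by end_near. Qed.

(** With mu = x h^a and h = 1 / n.+1, the coefficient of index n.+1 approximates the
    solution with lambda = x at time 1. *)
Lemma resolvent_term_scaled {R : realType} (a x : R) n k :
  resolvent_term a (x * n.+1%:R `^ (- a)) n.+1 k = (- x) ^+ k * gauss_ratio (k%:R * a) n.+1.
Proof.
rewrite /resolvent_term /gauss_ratio -mulNr exprMn -mulrA; congr (_ * _).
by rewrite mulrC -powR_mulrn ?powR_ge0// -powRrM mulNr powRN [a * _]mulrC.
Qed.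

Lemma scaled_lt1 {R : realType} (a x : R) : 0 < a -> 0 <= x ->
  exists n0, forall n, (n0 <= n)%N -> 0 <= x * n.+1%:R `^ (- a) < 1.
Proof.
move=> a0 x0; exists (Num.bound (x `^ a^-1)) => n n0n.
rewrite mulr_ge0 ?powR_ge0//= powRN ltr_pdivrMr ?powR_gt0// mul1r.
have -> : x = (x `^ a^-1) `^ a by rewrite -powRrM mulVf ?gt_eqF// powRr1.
rewrite gt0_ltr_powR// ?nnegrE ?powR_ge0//.
by rewrite (lt_le_trans (archi_boundP (powR_ge0 _ _)))// ler_nat ltnW.
Qed.

(** Term by term this is Gauss's formula; the terms for n >= n0 are dominated by
    those for n0, whose series converges once x n0.+1^(-a) < 1. *)
Lemma cvg_resolvent_mittag_leffler {R : realType} (a x : R) : 0 < a <= 1 -> 0 <= x ->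
  resolvent_coef a (x * n.+1%:R `^ (- a)) n.+1 @[n --> \oo] --> mittag_leffler a (- x).
Proof.
move=> a01 x0; have /andP[a0 a1] := a01.
have [n0 n0P] := scaled_lt1 a x a0 x0.
have /andP[mu0 _] := n0P _ (leqnn n0).
apply: (cvg_limn_series _ _
  (fun k => (x * n0.+1%:R `^ (- a)) ^+ k * negbin (k%:R * a + 1) n0.+1) n0).
- move=> n k n0n; rewrite -norm_resolvent_term ?(ltW a0)//.
  have ka0 : 0 <= k%:R * a by rewrite mulr_ge0// ltW.
  have gp l := ltW (gauss_ratio_gt0 (k%:R * a) l ka0).
  rewrite !resolvent_term_scaled normrM [leRHS]normrM !(ger0_norm (gp _)).
  by rewrite ler_wpM2l// gauss_ratio_nonincreasing.
- by apply: is_cvg_series_negbin_affine => //; exact: n0P.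
- move=> k; under eq_fun do rewrite resolvent_term_scaled.
  apply: cvgM; first exact: cvg_cst.
  by apply: cvg_gauss_ratio; rewrite mulr_ge0// ltW.
Qed.

(** The bounds on the discrete resolvent pass to the limit.  This is the part of the
    complete monotonicity of x |-> E_a(-x) that the theorem uses. *)
Lemma mittag_leffler_bounds {R : realType} (a x y : R) : 0 < a <= 1 -> 0 <= x -> x <= y ->
  0 <= mittag_leffler a (- y) <= mittag_leffler a (- x).
Proof.
move=> a01 x0 xy; have /andP[a0 _] := a01.
have y0 : 0 <= y := le_trans x0 xy.
have cx := cvg_resolvent_mittag_leffler a x a01 x0.
have cy := cvg_resolvent_mittag_leffler a y a01 y0.
have [n0 n0P] := scaled_lt1 a y a0 y0.
have B n : (n0 <= n)%N -> 0 <= resolvent_coef a (y * n.+1%:R `^ (- a)) n.+1 <=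
   resolvent_coef a (x * n.+1%:R `^ (- a)) n.+1.
  move=> n0n; have /andP[_ y1] := n0P _ n0n; apply: resolvent_coef_bounds => //.
    by rewrite mulr_ge0 ?powR_ge0.
  by rewrite ler_wpM2r ?powR_ge0.
apply/andP; split.
  by apply: (cvgr_to_ge cy); exists n0 => // n /B /andP[].
rewrite -subr_ge0; apply: (cvgr_to_ge (cvgB cx cy)); exists n0 => // n /B /andP[_].
by rewrite subr_ge0.
Qed.

(** * Smooth bumps and smooth steps *)

(** Smoothness by coinduction: it suffices to belong to a class of differentiable
    functions that is stable under differentiation. *)
Lemma smooth_coind {R : realType} (P : (R -> R) -> Prop) :
  (forall f, P f -> (forall x, derivable f x 1) /\ P (derive1 f)) ->
  forall f, P f -> smooth f.
Proof.
move=> H f Pf n; have : P (derive1n n f).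
  by elim: n => //= n IHn; exact: (H _ IHn).2.
by move=> /H[].
Qed.

Lemma smooth_derive1 {R : realType} (f : R -> R) : smooth f -> smooth (derive1 f).
Proof. by move=> sf n x; rewrite /derive1n -iterSr; exact: (sf n.+1). Qed.

Lemma is_derive_le_sqr {R : realType} (f : R -> R) (a C : R) :
  f a = 0 -> (forall x, `|f x| <= C * (x - a) ^+ 2) -> is_derive a 1 f 0.
Proof.
move=> fa fC.
have H : h^-1 *: ((f \o shift a) (h *: 1) - f a) @[h --> 0^'] --> (0 : R).
  apply/cvgr0Pnorm_le => e e0.
  have C0 : 0 <= C.
    by have := fC (a + 1); rewrite addrAC subrr add0r expr1n mulr1; exact: le_trans.
  near=> h.
  have h0 : h != 0 by near: h; exact: nbhs_dnbhs_neq.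
  rewrite /= fa subr0 [_ *: 1]mulr1 normrZ normfV ler_pdivrMl ?normr_gt0//.
  apply: (le_trans (fC _)); rewrite addrK -real_normK ?num_real// expr2 mulrA mulrC.
  rewrite ler_wpM2l//.
  have hC : `|h| <= e / (C + 1).
    near: h; apply: dnbhs0_le; rewrite divr_gt0// ltr_wpDl//.
  apply: (@le_trans _ _ ((C + 1) * `|h|)); first by rewrite ler_wpM2r// lerDl.
  by rewrite mulrC -ler_pdivlMr// ltr_wpDl.
by split; [apply/cvg_ex; exists 0|exact/cvg_lim].
Unshelve. all: by end_near. Qed.

Section bump_fun.
Context {R : realType} (a c : R).
Implicit Types (p : {poly R}) (k : nat).

Definition bump_base : {poly R} := ('X - a%:P) * (c%:P - 'X).
Let W := bump_base.

(** The usual bump exp(-1/((x-a)(c-x))) on ]a, c[, with a polynomial factor and a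
    power of 1/((x-a)(c-x)), so that the family is stable under differentiation. *)
Definition bump_fun p k (x : R) : R :=
  if a < x < c then p.[x] * W.[x]^-1 ^+ k * expR (- W.[x]^-1) else 0.

Definition bump_deriv p k : {poly R} :=
  p^`() * W ^+ 2 - k%:R *: (p * W^`() * W) + p * W^`().

Lemma bump_base_gt0 x : a < x < c -> 0 < W.[x].
Proof. by move=> /andP[ax xc]; rewrite !hornerE mulr_gt0 ?subr_gt0. Qed.

Lemma is_derive_bump_in p k x : a < x < c ->
  is_derive x 1 (bump_fun p k) (bump_fun (bump_deriv p k) k.+2 x).
Proof.
move=> xac.
have W0 : W.[x] != 0 by rewrite gt_eqF// bump_base_gt0.
(* removes the predecessor, which would force a case analysis on k *)
have kE : k%:R * W.[x]^-1 ^+ k.-1 = k%:R * W.[x]^-1 ^+ k * W.[x].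
  by case: k => [|k]; rewrite ?mul0r// exprSr/= -mulrA mulfVK.
pose f (y : R) := p.[y] * W.[y]^-1 ^+ k * expR (- W.[y]^-1).
apply: (@near_eq_is_derive _ _ _ f).
  near=> y; rewrite /bump_fun /f ifT//.
  have : y \in `]a, c[ by near: y; apply: near_in_itvoo; rewrite in_itv.
  by rewrite in_itv.
have DW : is_derive x 1 (horner W) W^`().[x] := is_derive_poly W x.
have DV : is_derive x 1 (fun y => W.[y]^-1) (- W.[x] ^- 2 * W^`().[x]).
  exact: (is_deriveV W0 DW).
have DX : is_derive x 1 (fun y => W.[y]^-1 ^+ k)
   (k%:R * W.[x]^-1 ^+ k.-1 * (- W.[x] ^- 2 * W^`().[x])).
  have -> : (fun y => W.[y]^-1 ^+ k) = (fun y => W.[y]^-1) ^+ k.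
    by apply/funext => y; rewrite fctE.
  exact: is_deriveX.
have DN : is_derive x 1 (fun y => - W.[y]^-1) (W.[x] ^- 2 * W^`().[x]).
  by apply: is_derive_eq (is_deriveN DV) _; rewrite mulNr opprK.
have DE : is_derive x 1 (fun y => expR (- W.[y]^-1)) (expR (- W.[x]^-1) * (W.[x] ^- 2 * W^`().[x])).
  exact: (is_derive1_comp (is_derive_expR _) DN).
have Dp := is_derive_poly p x.
apply: (is_derive_eq (is_deriveM (is_deriveM Dp DX) DE)).
rewrite kE /bump_fun xac.
have -> : (bump_deriv p k).[x] =
    p^`().[x] * W.[x] ^+ 2 - k%:R * (p.[x] * W^`().[x] * W.[x]) + p.[x] * W^`().[x].
  by rewrite /bump_deriv; move: W => V; rewrite !hornerE.
(* evaluates the products of functions without expanding W *)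
change (p.[x] * W.[x]^-1 ^+ k * (expR (- W.[x]^-1) * (W.[x] ^- 2 * W^`().[x])) +
   expR (- W.[x]^-1) * (p.[x] * (k%:R * W.[x]^-1 ^+ k * W.[x] * (- W.[x] ^- 2 * W^`().[x])) +
   W.[x]^-1 ^+ k * p^`().[x]) = (p^`().[x] * W.[x] ^+ 2 - k%:R * (p.[x] * W^`().[x] * W.[x]) +
   p.[x] * W^`().[x]) * W.[x]^-1 ^+ k.+2 * expR (- W.[x]^-1)).
move: (W.[x]) W0 (W^`().[x]) => w w0 w'.
rewrite !exprSr; move: (w^-1 ^+ k) => wk; field.
exact: w0.
Unshelve. all: by end_near. Qed.

(** The exponential beats every power of 1/W, where W = (x - a) (c - x): for
    u = 1/W and j = k.+2, u^j e^(-u) <= j^j follows from u/j <= e^(u/j).  Hence the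
    function is O(W^2), so that it is differentiable at a and at c too. *)
Lemma bump_fun_le_sqr p k : exists C, 0 <= C /\
  forall x, `|bump_fun p k x| <= C * (x - a) ^+ 2 /\ `|bump_fun p k x| <= C * (x - c) ^+ 2.
Proof.
have [ac|ca] := ltP a c; last first.
  exists 0; split=> // x; rewrite /bump_fun ifN ?normr0 ?mul0r//.
  by rewrite negb_and -!leNgt; case: (leP x a) => //= ax; rewrite (le_trans ca)// ltW.
have cp : {within `[a, c], continuous (fun x => `|p.[x]|)}.
  apply: continuous_subspaceT => x.
  by apply: cvg_norm; exact: continuous_horner.
have [m _ mP] := EVT_max (ltW ac) cp.
pose n : R := k.+2%:R ^+ k.+2.
have n0 : 0 <= n by rewrite exprn_ge0.
have C0 : 0 <= `|p.[m]| * n * (c - a) ^+ 2.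
  by rewrite mulr_ge0 ?sqr_ge0// mulr_ge0.
exists (`|p.[m]| * n * (c - a) ^+ 2); split=> // x; rewrite /bump_fun.
case: ifPn => [xac|_]; last by rewrite normr0; split; rewrite mulr_ge0 ?sqr_ge0.
have w0 := bump_base_gt0 x xac; have /andP[ax xc] := xac.
have K : `|p.[x] * W.[x]^-1 ^+ k * expR (- W.[x]^-1)| <= `|p.[m]| * n * W.[x] ^+ 2.
  rewrite -mulrA normrM -mulrA; apply: ler_pM => //.
    by apply: mP; rewrite in_itv/= !ltW.
  have u0 : 0 < W.[x]^-1 by rewrite invr_gt0.
  rewrite ger0_norm ?mulr_ge0 ?exprn_ge0 ?expR_ge0 ?(ltW u0)//.
  move: (W.[x]) w0 u0 => w w0 u0.
  have H : (w^-1) ^+ k.+2 <= n * expR (w^-1).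
    have -> : w^-1 = k.+2%:R * (w^-1 / k.+2%:R) by rewrite mulrCA divff ?mulr1// pnatr_eq0.
    rewrite exprMn ler_wpM2l// expRM_natl lerXn2r ?nnegrE ?expR_ge0 ?divr_ge0 ?(ltW u0)//.
    by apply: le_trans (expR_ge1Dx _); rewrite lerDr.
  rewrite expRN ler_pdivrMr ?expR_gt0//.
  have -> : w^-1 ^+ k = w^-1 ^+ k.+2 * w ^+ 2.
    by rewrite !exprSr; field; rewrite gt_eqF.
  by rewrite [leRHS]mulrAC ler_wpM2r// sqr_ge0.
have ac0 : 0 <= c - a by rewrite subr_ge0 ltW.
have pn : 0 <= `|p.[m]| * n by rewrite mulr_ge0.
rewrite -(sqrrN (x - c)) opprB.
split; apply: (le_trans K); rewrite -[leRHS]mulrA ler_wpM2l// -exprMn lerXn2r// ?nnegrE ?(ltW w0)//.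
- by rewrite mulr_ge0// subr_ge0 ltW.
- by rewrite !hornerE mulrC ler_wpM2r ?subr_ge0 ?(ltW ax)// lerD2l lerN2 ltW.
- by rewrite mulr_ge0// subr_ge0 ltW.
- by rewrite !hornerE ler_wpM2r ?subr_ge0 ?(ltW xc)// lerD2r ltW.
Qed.

Lemma is_derive_bump p k (x : R) : is_derive x 1 (bump_fun p k) (bump_fun (bump_deriv p k) k.+2 x).
Proof.
have [xac|xac] := boolP (a < x < c); first exact: is_derive_bump_in.
have [C [C0 HC]] := bump_fun_le_sqr p k.
have b0 q j : bump_fun q j x = 0 by rewrite /bump_fun ifN.
rewrite b0.
have [xa|xa] := eqVneq x a.
  by rewrite xa in b0 *; apply: (@is_derive_le_sqr _ _ _ C) => // y; exact: (HC y).1.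
have [xc|xc] := eqVneq x c.
  by rewrite xc in b0 *; apply: (@is_derive_le_sqr _ _ _ C) => // y; exact: (HC y).2.
apply: (@near_eq_is_derive _ _ _ (cst 0)).
move: xac; rewrite negb_and -!leNgt !le_eqVlt (negbTE xa) eq_sym (negbTE xc)/= => /orP[xa'|xc'].
- near=> y; rewrite /bump_fun ifN// negb_and -!leNgt ltW//.
  by near: y; exact: lt_nbhsl.
- near=> y; rewrite /bump_fun ifN// negb_and -!leNgt orbC ltW//.
  by near: y; exact: lt_nbhsr.
Unshelve. all: by end_near. Qed.

Lemma smooth_bump p k : smooth (bump_fun p k).
Proof.
apply: (@smooth_coind _ (fun f => exists p k, f = bump_fun p k)); last by exists p, k.
move=> _ [q [j ->]]; split.
  by move=> x; have [] := is_derive_bump q j x.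
exists (bump_deriv q j), j.+2; apply/funext => x.
by rewrite derive1E; have [_ ->] := is_derive_bump q j x.
Qed.

End bump_fun.

Section smooth_step.
Context {R : realType} (a c : R) (ac : a < c).
Let mu := @lebesgue_measure R.
Let b := bump_fun a c 1 0.
Let Phi x : R := \int[mu]_(t in `]-oo, x]) b t.

Let b_in x : a < x < c -> 0 < b x.
Proof.
by move=> xac; rewrite /b /bump_fun xac hornerC expr0 !mul1r expR_gt0.
Qed.

Let b_out x : ~~ (a < x < c) -> b x = 0.
Proof. by move=> xac; rewrite /b /bump_fun ifN. Qed.

Let b_ge0 x : 0 <= b x.
Proof.
by have [/b_in/ltW//|/b_out->] := boolP (a < x < c).
Qed.

Let b_cont : continuous b.
Proof.
move=> x; apply: differentiable_continuous; apply/derivable1_diffP.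
by have [] := is_derive_bump a c 1 0 x.
Qed.

Let b_intble D : measurable D -> mu.-integrable D (EFin \o b).
Proof.
move=> mD; apply: (@integrableS _ _ _ mu setT) => //.
have -> : EFin \o b = (EFin \o b) \_ `[a, c].
  apply/funext => x; rewrite patchE; case: ifPn => //= xac.
  rewrite b_out//; apply/negP => /andP[ax xc]; move/negP: xac; apply.
  by rewrite inE/= in_itv/= !ltW.
apply: (integrable_mkcond _ _).1 => //.
apply: continuous_compact_integrable; first exact: segment_compact.
exact: continuous_subspaceT.
Qed.

Let dPhi x : derivable Phi x 1 /\ Phi^`()%classic x = b x.
Proof.
apply: (@continuous_FTC1 R b -oo%O x (x + 1)).
- by rewrite ltrDl.
- exact: b_intble.
- by rewrite ltNyr.
- exact: b_cont.
Qed.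

Let Phi_mono x y : x <= y -> Phi x <= Phi y.
Proof.
move=> xy; rewrite -subr_ge0 Rintegral_itvB//; first by apply: Rintegral_ge0.
exact: b_intble.
Qed.

Let Phi_left x : x <= a -> Phi x = 0.
Proof.
move=> xa; rewrite /Phi (@eq_Rintegral _ _ _ mu _ (fun=> 0)).
  by rewrite Rintegral_cst// mul0r.
move=> t; rewrite inE/= in_itv/= => tx; rewrite b_out// negb_and -!leNgt (le_trans tx)//.
Qed.

Let Phi_right x : c <= x -> Phi x = Phi c.
Proof.
move=> cx; apply/eqP; rewrite -subr_eq0 Rintegral_itvB//; last exact: b_intble.
rewrite (@eq_Rintegral _ _ _ mu _ (fun=> 0)); first by rewrite Rintegral_cst// mul0r.
move=> t; rewrite inE/= in_itv/= => /andP[ct _]; rewrite b_out// negb_and -!leNgt orbC ltW//.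
Qed.

Let Phi_gt0 : 0 < Phi c.
Proof.
rewrite lt_neqAle eq_sym -[X in X <= _](Phi_left a)// Phi_mono ?ltW// andbT.
apply/negP => /eqP Phic.
pose m := (a + c) / 2.
have am : a < m := (midf_lt ac).1.
have mc : m < c := (midf_lt ac).2.
(* otherwise Phi would be constant, and its derivative would vanish at m *)
have : b m = 0.
  rewrite -(dPhi m).2 derive1E (@near_eq_derive _ _ _ _ (cst 0)) ?derive_cst//.
  near=> y.
  have ay : a <= y by apply: ltW; near: y; exact: lt_nbhsr.
  have yc : y <= c by apply: ltW; near: y; exact: lt_nbhsl.
  apply/eqP; rewrite eq_le -{1}Phic Phi_mono//= -[X in X <= _](Phi_left a)//.
  exact: Phi_mono.
by apply/eqP; rewrite gt_eqF// b_in// am.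
Unshelve. all: by end_near. Qed.

(** The normalized primitive of a bump supported in [a, c]. *)
Lemma smooth_step : exists S : R -> R, [/\ smooth S, forall x, 0 <= S x <= 1,
  forall x, x <= a -> S x = 0, forall x, c <= x -> S x = 1 &
  forall x, 0 <= derive1 S x /\ (~~ (a < x < c) -> derive1 S x = 0)].
Proof.
pose S x := (Phi c)^-1 * Phi x.
have dS x : derivable S x 1 /\ derive1 S x = bump_fun a c ((Phi c)^-1)%:P 0 x.
  have [d1 d2] := dPhi x.
  have D : is_derive x 1 Phi (b x) by split=> //; rewrite -derive1E.
  have [e1 e2] := is_deriveZ (Phi c)^-1 D.
  split; first exact: e1.
  rewrite derive1E e2 /b /bump_fun /GRing.scale/=; case: ifP => _; last by rewrite mulr0.
  by rewrite !hornerC expr0 !mulr1 mul1r.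
exists S; split.
- apply: (@smooth_coind _ (fun f => f = S \/ exists p k, f = bump_fun a c p k)); last by left.
  move=> f [->|[p [k ->]]].
    split=> [x|]; first exact: (dS x).1.
    by right; exists ((Phi c)^-1)%:P, 0; apply/funext => x; rewrite (dS x).2.
  have sb := smooth_bump a c p k.
  split=> [x|]; first exact: (sb 0 x).
  right; exists (bump_deriv a c p k), k.+2; apply/funext => x.
  by rewrite derive1E; have [_ ->] := is_derive_bump a c p k x.
- move=> x; have [/Phi_left|xa] := leP x a; first by rewrite /S => ->; rewrite mulr0 lexx ler01.
  rewrite mulr_ge0 ?invr_ge0 ?(ltW Phi_gt0)//=; last by rewrite -(Phi_left a)// Phi_mono// ltW.
  rewrite /S mulrC ler_pdivrMr// mul1r.
  by have [/Phi_mono//|/ltW/Phi_right->] := leP x c.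
- by move=> x xa; rewrite /S (Phi_left x)// mulr0.
- by move=> x cx; rewrite /S (Phi_right x)// mulVf// gt_eqF.
- move=> x; rewrite (dS x).2 /bump_fun; split=> [|xac]; last by rewrite ifN.
  case: ifP => // _.
  by rewrite hornerC expr0 mulr1 mulr_ge0 ?expR_ge0// invr_ge0 ltW.
Qed.

End smooth_step.

(** * Testing the weak derivative *)

(** On a bounded interval |g| <= 1 + g^2. *)
Lemma L2_integrable {R : realType} (T : R) (g : R -> R) : L2 T g ->
  lebesgue_measure.-integrable `]0, T[ (EFin \o g).
Proof.
move=> Lg.
pose D : set R := `]0, T[%classic.
have mD : measurable D by exact: measurable_itv.
have mgD : measurable_fun setT (g \_ D).
  by move: Lg; rewrite /L2 inE => /andP[]; rewrite inE.
have mg : measurable_fun D g by apply/(measurable_restrictT _ mD).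
have i2 := Lfun2_integrable_sqr Lg.
have i1 : lebesgue_measure.-integrable D (EFin \o cst (1 : R)).
  apply: (@integrableS _ _ _ (@lebesgue_measure R) `[0, T]) => //; first by apply: subset_itvW.
  apply: continuous_compact_integrable; first exact: segment_compact.
  by apply: continuous_subspaceT; exact: cst_continuous.
have i3 : lebesgue_measure.-integrable D (EFin \o (fun x => (g \_ D) x ^+ 2)).
  exact: (integrableS _ _ _ i2).
have mD' : measurable (D : set (measurableTypeR R)) by [].
have := integrableD mD' i1 i3; apply: le_integrable => //.
  exact/measurable_EFinP.
move=> x Dx /=; rewrite patchE mem_set// lee_fin.
rewrite [leRHS]ger0_norm; last by rewrite addr_ge0// sqr_ge0.
rewrite -(real_normK (num_real (g x))).
by move: (`|g x|) => y; nra.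
Qed.

(** Near x the difference quotient is bounded by 1 + |l|, where l is its limit. *)
Lemma differentiable_on_continuous {R : realType} (J : set R) (f : R -> R) :
  differentiable_on J f -> {within J, continuous f}.
Proof.
move=> df; apply/subspace_continuousP => x Jx.
have /cvg_ex[/= l] := df x Jx.
move=> /cvgrPdist_le/(_ 1 ltr01); rewrite near_withinE /dnbhs near_withinE => H.
apply/cvgrPdist_le => e e0; rewrite near_withinE.
have C0 : 0 < `|l| + 1 by rewrite ltr_wpDl.
near=> y => Jy.
have [->|yx] := eqVneq y x; first by rewrite subrr normr0 ltW.
have q1 : `|l - (f y - f x) / (y - x)| <= 1 by move: yx Jy; near: y.
have q : `|(f y - f x) / (y - x)| <= `|l| + 1.
  have -> : (f y - f x) / (y - x) = l - (l - (f y - f x) / (y - x)) by ring.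
  by apply: (le_trans (ler_normB _ _)); rewrite lerD2l.
have yx0 : y - x != 0 by rewrite subr_eq0.
rewrite distrC -[f y - f x](divfK yx0) normrM.
have h : `|y - x| <= e / (`|l| + 1).
  by rewrite distrC; near: y; apply: cvgr_dist_le => //; rewrite divr_gt0.
apply: (le_trans (ler_pM _ _ q h)) => //.
by rewrite mulrC divfK// gt_eqF.
Unshelve. all: by end_near. Qed.

Lemma smooth_continuous {R : realType} (f : R -> R) : smooth f -> continuous f.
Proof.
move=> sf x; apply: differentiable_continuous; apply/derivable1_diffP.
exact: (sf 0 x).
Qed.

Lemma derive1_smoothB {R : realType} (f g : R -> R) : smooth f -> smooth g ->
  derive1 (f \- g) = derive1 f \- derive1 g.
Proof.
move=> sf sg; apply/funext => x; rewrite derive1E deriveB -?derive1E//.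
  exact: (sf 0 x).
exact: (sg 0 x).
Qed.

Lemma smoothB {R : realType} (f g : R -> R) : smooth f -> smooth g -> smooth (f \- g).
Proof.
move=> sf sg.
apply: (@smooth_coind _ (fun h => exists u v,
  [/\ smooth u, smooth v & h = u \- v])); last by exists f, g.
move=> _ [u [v [su sv ->]]]; split=> [x|].
  by apply: derivableB; [exact: (su 0 x)|exact: (sv 0 x)].
exists (derive1 u), (derive1 v).
by split; [exact: smooth_derive1..|exact: derive1_smoothB].
Qed.

(** The plateau phi is a smooth step S1, rising on [a, a'], minus a smooth step S2,
    rising on [b, b'].  Testing the weak derivative against it gives
    int g phi = int m S2' - int m S1', where S1' and S2' are nonnegative, supported
    in [a, a'] and in [b, b'] respectively, and S2' has integral 1: the second
    integral is nonnegative as m is so on [a, a'], and the first one is an average of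
    m over [b, b']. *)
Lemma weak_derivative_plateau {R : realType} (T : R) (m g : R -> R) (a a' b b' : R) :
  0 < a -> a < a' -> a' < b -> b < b' -> b' < T ->
  {within `[0, T], continuous m} -> is_weak_derivative T m g ->
  (forall x, a <= x <= a' -> 0 <= m x) ->
  exists phi : R -> R, [/\ continuous phi, forall x, 0 <= phi x <= 1,
    forall x, a' <= x <= b -> phi x = 1, forall x, ~~ (a < x < b') -> phi x = 0 &
    forall eta, (forall x, b <= x <= b' -> m x <= eta) ->
    \int[lebesgue_measure]_(x in `]0, T[) (g x * phi x) <= eta].
Proof.
move=> a0 aa' a'b bb' b'T cm wd ma.
have [S1 [s1 S1b S1l S1r S1d]] := smooth_step a a' aa'.
have [S2 [s2 S2b S2l S2r S2d]] := smooth_step b b' bb'.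
pose phi := S1 \- S2.
have sphi : smooth phi by exact: smoothB.
have phi_out x : ~~ (a < x < b') -> phi x = 0.
  rewrite negb_and -!leNgt => /orP[xa|b'x].
    by rewrite /phi/= S1l// S2l ?subrr//; lra.
  by rewrite /phi/= S1r ?S2r ?subrr//; lra.
have T0 : 0 < T by lra.
have b0 : 0 <= b by lra.
exists phi; split => //.
- exact: smooth_continuous.
- move=> x; rewrite /phi /=; have [xb|bx] := leP x b.
    by rewrite S2l// subr0.
  rewrite S1r; last by lra.
  by have := S2b x; lra.
- by move=> x xab; rewrite /phi/= S1r ?S2l ?subr0//; lra.
move=> eta meta.
have tphi : test_function T phi.
  have sub : closure [set x | phi x != 0] `<=` `[a, b'].
    rewrite [X in _ `<=` X](closure_id _).1; last exact: itv_closed.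
    apply: closure_subset => x /= x0; rewrite in_itv/=.
    have [/andP[ax xb]|/phi_out px] := boolP (a < x < b'); first by rewrite !ltW.
    by rewrite px eqxx in x0.
  split => //.
    apply: (subclosed_compact _ _ sub); first exact: closed_closure.
    exact: segment_compact.
  move=> x /sub; rewrite /= !in_itv/=; lra.
have mD : measurable (`]0, T[%classic : set R) by exact: measurable_itv.
have itg (h : R -> R) : {within `[0, T], continuous h} ->
    lebesgue_measure.-integrable `]0, T[ (EFin \o h).
  move=> ch; apply: (@integrableS _ _ _ (@lebesgue_measure R) `[0, T]) => //; last first.
    by apply: continuous_compact_integrable => //; exact: segment_compact.
  by move=> x /=; rewrite !in_itv/=; lra.
have cS (S : R -> R) : smooth S -> {within `[0, T], continuous (derive1 S)}.
  by move=> sS; apply: continuous_subspaceT; exact/smooth_continuous/smooth_derive1.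
have c1 := within_continuousM _ _ _ cm (cS _ s1).
have c2 := within_continuousM _ _ _ cm (cS _ s2).
have E : \int[lebesgue_measure]_(x in `]0, T[) (m x * derive1 phi x) =
    \int[lebesgue_measure]_(x in `]0, T[) (m x * derive1 S1 x) -
    \int[lebesgue_measure]_(x in `]0, T[) (m x * derive1 S2 x).
  rewrite -RintegralB//; [|exact: itg..].
  by apply: eq_Rintegral => x _; rewrite /phi derive1_smoothB//= mulrBr.
have I1 : 0 <= \int[lebesgue_measure]_(x in `]0, T[) (m x * derive1 S1 x).
  apply: Rintegral_ge0 => x _; have [d0 d1] := S1d x.
  have [/andP[ax xa]|/d1->] := boolP (a < x < a'); last by rewrite mulr0.
  by rewrite mulr_ge0// ma// !ltW.
have I2 : \int[lebesgue_measure]_(x in `]0, T[) (m x * derive1 S2 x) <= eta.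
  have c3 : {within `[0, T], continuous (fun x => eta * derive1 S2 x)}.
    apply: within_continuousM; last exact: cS.
    by apply: continuous_subspaceT; exact: cst_continuous.
  apply: (@le_trans _ _ (\int[lebesgue_measure]_(x in `]0, T[) (eta * derive1 S2 x))).
    apply: le_Rintegral => //; [exact: itg|exact: itg|].
    move=> x _; have [d0 d1] := S2d x.
    have [/andP[bx xb]|/d1->] := boolP (b < x < b'); last by rewrite !mulr0.
    by rewrite ler_wpM2r// meta// !ltW.
  rewrite RintegralZl//; last exact: itg (cS _ s2).
  have cS2 : continuous S2 by exact: smooth_continuous.
  rewrite (_ : \int[_]_(_ in _) _ = 1) ?mulr1//.
  rewrite /Rintegral -(@integral_itv_bndoo _ _ _ _ true false); last first.
    apply/measurable_EFinP; apply: measurable_funTS; apply: continuous_measurable_fun.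
    exact/smooth_continuous/smooth_derive1.
  rewrite (@continuous_FTC2 _ _ S2)//=.
  - by rewrite (S2r T) ?(ltW b'T)// (S2l 0)// subr0.
  - exact: cS.
  - split; first by move=> x _; exact: (s2 0 x).
      by apply: cvg_at_right_filter; exact: cS2.
    by apply: cvg_at_left_filter; exact: cS2.
have := wd _ tphi; rewrite E => /(congr1 -%R); rewrite opprK opprB => <-.
by rewrite lerBlDr (le_trans I2)// lerDl.
Qed.

(** Formally the integral is m t - m s.  Only the sign is needed, which avoids
    identifying g with the pointwise derivative of m: plateaus that fill ]s, t[ from
    the inside converge to its indicator function, and m is small on their right
    flanks by continuity at t. *)
Lemma integral_weak_derivative_le0 {R : realType} (T : R) (m g : R -> R) (s t : R) :
  0 <= s -> s < t -> t <= T ->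
  {within `[0, T], continuous m} -> is_weak_derivative T m g ->
  lebesgue_measure.-integrable `]0, T[ (EFin \o g) ->
  (forall x, 0 <= x < t -> 0 <= m x) -> m t = 0 ->
  \int[lebesgue_measure]_(x in `]s, t[) g x <= 0.
Proof.
move=> s0 st tT cm wd ig mge mt.
(* a fifth, so that s + 2 e < t - 2 e leaves room for the plateau *)
pose e n : R := (t - s) / 5 / n.+1%:R.
have e0 n : 0 < e n by rewrite !divr_gt0// subr_gt0.
have eS n : e n <= (t - s) / 5.
  by rewrite ler_pdivrMr// ler_peMr ?ler1n// divr_ge0// subr_ge0 ltW.
have e_small d : 0 < d -> \forall n \near \oo, e n <= d.
  move=> d0; have : e n @[n --> \oo] --> (t - s) / 5 * 0.
    by apply: cvgM; [exact: cvg_cst|exact: cvg_harmonic].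
  by rewrite mulr0 => H; have := cvgr_le _ H; apply.
have /choice[phi phiP] : forall n, exists phi : R -> R, [/\ continuous phi,
    forall x, 0 <= phi x <= 1,
    forall x, s + 2 * e n <= x <= t - 2 * e n -> phi x = 1,
    forall x, ~~ (s + e n < x < t - e n) -> phi x = 0 &
    forall eta, (forall x, t - 2 * e n <= x <= t - e n -> m x <= eta) ->
    \int[lebesgue_measure]_(x in `]0, T[) (g x * phi x) <= eta].
  move=> n; have := e0 n; have := eS n; move: (e n) => d dS d0.
  apply: (@weak_derivative_plateau _ _ m) => //; [lra..|].
  by move=> x xs; apply: mge; lra.
pose D : set (measurableTypeR R) := `]0, T[%classic.
have mD : measurable D by exact: measurable_itv.
have mst : measurable (`]s, t[%classic : set (measurableTypeR R)) by exact: measurable_itv.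
have mg : measurable_fun D (EFin \o g) by case/integrableP : ig.
pose f_ n x := (g x * phi n x)%:E.
pose f := (EFin \o g) \_ `]s, t[.
have subD : `]s, t[ `<=` D by apply: subset_itv; rewrite bnd_simp.
have mf_ n : measurable_fun D (f_ n).
  apply/measurable_EFinP; apply: measurable_funM; first exact/measurable_EFinP.
  by apply: measurable_funTS; apply: continuous_measurable_fun; have [] := phiP n.
have fE : (\int[lebesgue_measure]_(x in D) f x = \int[lebesgue_measure]_(x in `]s, t[) (g x)%:E)%E.
  by rewrite /f -integral_mkcondr; congr (integral _ _ _); exact: setIidr.
have mf : measurable_fun D f.
  apply: (measurable_restrict (EFin \o g) mst mD).1.
  by apply: measurable_funS mg => //; exact: subIsetl.
have ff x : f_ ^~ x @ \oo --> f x.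
  rewrite /f patchE; case: ifPn => [|].
    rewrite inE/= in_itv/= => /andP[sx xt].
    apply: cvg_near_cst.
    have h1 := e_small ((x - s) / 2); have h2 := e_small ((t - x) / 2).
    near=> n; have [_ _ p1 _ _] := phiP n.
    rewrite /f_ p1 ?mulr1//.
    have : e n <= (x - s) / 2 by near: n; apply: h1; lra.
    have : e n <= (t - x) / 2 by near: n; apply: h2; lra.
    lra.
  move=> xst; apply: cvg_near_cst; apply: nearW => n; rewrite /f_.
  have [_ _ _ p0 _] := phiP n; rewrite p0 ?mulr0//.
  apply: contra xst; rewrite inE/= in_itv/=; have := e0 n; lra.
have fg x n : D x -> (`|f_ n x| <= `|(EFin \o g) x|)%E.
  move=> _; rewrite /f_ /= lee_fin normrM.
  have [_ p1 _ _ _] := phiP n; have /andP[p10 p11] := p1 x.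
  by rewrite (ger0_norm p10) ler_piMr.
have iag : lebesgue_measure.-integrable D (fun x => `|(EFin \o g) x|%E).
  exact: integrable_abse.
have [_ _ H] : [/\ lebesgue_measure.-integrable D f,
    [sequence \int[lebesgue_measure]_(x in D) `|f_ n x - f x|]_n @ \oo --> 0 &
    [sequence \int[lebesgue_measure]_(x in D) (f_ n x)]_n @ \oo -->
      \int[lebesgue_measure]_(x in D) (f x)]%E.
  apply: (dominated_convergence mD mf_ mf _ iag); apply: aeW => x //.
  by move=> n; exact: fg.
rewrite /Rintegral -fE; apply: fine_le0.
apply/lee_addgt0Pr => eta eta0; rewrite add0e.
apply: (cvge_to_le H).
have m_small : \forall x \near within `[0, T] (nbhs t), m x <= eta.
  have mt0 : m x @[x --> within `[0, T] (nbhs t)] --> (0 : R).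
    rewrite -[X in _ --> X]mt; move/subspace_continuousP : cm; apply.
    by rewrite /= in_itv/= tT andbT (le_trans s0)// ltW.
  exact: (cvgr_le _ mt0).
move: m_small; rewrite near_withinE => -[d /= d0 md].
have d20 : 0 < d / 3 by rewrite divr_gt0.
near=> n.
have I : \int[lebesgue_measure]_(x in `]0, T[) (g x * phi n x) <= eta.
  have [_ _ _ _ p] := phiP n; apply: p => x /andP[xl xr].
  have ed : e n <= d / 3 by near: n; exact: e_small.
  have en := e0 n; have es := eS n.
  apply: md.
    by rewrite /ball/= ger0_norm; lra.
  by rewrite /= in_itv/=; apply/andP; split; lra.
have ifn : lebesgue_measure.-integrable D (f_ n).
  by apply: le_integrable iag => // x Dx; rewrite abse_id; exact: fg.
by rewrite -[X in (X <= _)%E]fineK ?lee_fin//; exact: integrable_fin_num.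
Unshelve. all: by end_near. Qed.

(** * Integrating against a monotone weight *)

(** Such a set is empty, ]s, t[ or [s, t[, where s is its infimum. *)
Lemma integral_up_set_le0 {R : realType} (t : R) (g : R -> R) (A : set R) :
  (forall s, 0 <= s < t -> \int[lebesgue_measure]_(x in `]s, t[) g x <= 0) ->
  lebesgue_measure.-integrable `]0, t[ (EFin \o g) ->
  A `<=` `]0, t[ -> (forall x y, A x -> x <= y -> y < t -> A y) ->
  measurable (A : set (measurableTypeR R)) /\ \int[lebesgue_measure]_(x in A) g x <= 0.
Proof.
move=> gle ig At Aup.
have [->|/set0P[z Az]] := eqVneq A set0.
  by split; [exact: measurable0|rewrite Rintegral_set0].
have lbA : has_inf A.
  by split; [exists z|exists 0 => x /At; rewrite /= in_itv/= => /andP[/ltW]].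
pose s := inf A.
have s0 : 0 <= s.
  apply: lb_le_inf; first by exists z.
  by move=> x /At; rewrite /= in_itv/= => /andP[/ltW].
have sA x : A x -> s <= x by move=> Ax; apply: ge_inf => //; exact: lbA.2.
have st : s < t.
  by apply: (le_lt_trans (sA _ Az)); have := At _ Az; rewrite /= in_itv/= => /andP[].
have Aoo x : s < x -> x < t -> A x.
  move=> sx xt; have [y Ay yx] : exists2 y, A y & y < x.
    by exact: (inf_lt lbA.1 sx).
  exact: (Aup y x Ay (ltW yx) xt).
have gst : \int[lebesgue_measure]_(x in `]s, t[) g x <= 0 by apply: gle; rewrite s0.
have [As|As] := pselect (A s).
  have -> : A = `[s, t[%classic.
    apply/seteqP; split=> x /=; rewrite in_itv/=.
      by move=> Ax; rewrite sA//=; have := At _ Ax; rewrite /= in_itv/= => /andP[].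
    move=> /andP[]; rewrite le_eqVlt => /predU1P[<- //|]; exact: Aoo.
  split; first exact: measurable_itv.
  rewrite -Rintegral_itv_obnd_cbnd//; apply: integrableS ig => //.
  by apply: subset_itv; rewrite bnd_simp.
have -> : A = `]s, t[%classic; last by split; first exact: measurable_itv.
apply/seteqP; split=> x /=; rewrite in_itv/=; last by move=> /andP[]; exact: Aoo.
move=> Ax; have := At _ Ax; rewrite /= in_itv/= => /andP[_ ->]; rewrite andbT.
by rewrite lt_neqAle sA// andbT; apply/eqP => sx; apply: As; rewrite sx.
Qed.

(** For d > 0 and y >= 0, the largest multiple i d of d with i d <= y and i <= n,
    written as a layer-cake sum. *)
Definition staircase {R : realType} (d y : R) n : R :=
  \sum_(i < n) d * (i.+1%:R * d <= y)%R%:R.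

Lemma staircase_bounds {R : realType} (d y : R) n : 0 <= d -> 0 <= y <= n%:R * d ->
  y - d <= staircase d y n <= y.
Proof.
move=> d0 /andP[y0 yn].
have H : if n%:R * d <= y then staircase d y n = n%:R * d else y - d <= staircase d y n <= y.
  elim: n {yn} => [|n IHn]; first by rewrite /staircase big_ord0 mul0r y0.
  have E : n.+1%:R * d = n%:R * d + d by rewrite -natr1; ring.
  rewrite /staircase big_ord_recr /= -/(staircase d y n) E.
  move: IHn; case: (leP (n%:R * d) y) => h1; case: (leP (n%:R * d + d) y) => h2 /=.
  - by move=> ->; rewrite mulr1.
  - by move=> ->; rewrite mulr0; lra.
  - by move=> h3; lra.
  - by rewrite mulr0 addr0.
move: H; case: ifP => [h|//] ->; lra.
Qed.

Lemma integral_sum_le0 {R : realType} (D : set (measurableTypeR R)) (F : nat -> R -> R) n :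
  measurable D -> (forall i, lebesgue_measure.-integrable D (EFin \o F i)) ->
  (forall i, \int[lebesgue_measure]_(x in D) F i x <= 0) ->
  lebesgue_measure.-integrable D (EFin \o (fun x => \sum_(i < n) F i x)) /\
  \int[lebesgue_measure]_(x in D) (\sum_(i < n) F i x) <= 0.
Proof.
move=> mD iF F0; elim: n => [|n [IH1 IH2]].
  have -> : (fun x => \sum_(i < 0) F i x) = cst 0 by apply/funext => x; rewrite big_ord0.
  split; first exact: integrable0.
  by rewrite /Rintegral integral0.
have -> : (fun x => \sum_(i < n.+1) F i x) = (fun x => \sum_(i < n) F i x + F n x).
  by apply/funext => x; rewrite big_ord_recr.
split; first exact: (integrableD mD IH1 (iF n)).
rewrite RintegralD//.
have := F0 n; move: IH2; move: (\int[_]_(_ in _) _) (\int[_]_(_ in _) _) => a b; lra.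
Qed.

(** Layer cake: the weight k is the limit of sums of indicator functions of its
    superlevel sets, which are closed upwards as k is nondecreasing.  Measurability
    of k g comes from the same approximation. *)
Lemma integral_nondecreasing_le0 {R : realType} (t M : R) (k g : R -> R) :
  0 < t ->
  (forall s, 0 <= s < t -> \int[lebesgue_measure]_(x in `]s, t[) g x <= 0) ->
  lebesgue_measure.-integrable `]0, t[ (EFin \o g) ->
  (forall x, 0 < x < t -> 0 <= k x <= M) ->
  (forall x y, 0 < x -> x <= y -> y < t -> k x <= k y) ->
  measurable_fun (`]0, t[%classic : set R) (fun x => k x * g x) /\
  \int[lebesgue_measure]_(x in `]0, t[) (k x * g x) <= 0.
Proof.
move=> t0 gle ig kM km.
pose D : set (measurableTypeR R) := `]0, t[%classic.
have mD : measurable D by exact: measurable_itv.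
have M0 : 0 <= M.
  have /kM/andP[] : 0 < t / 2 < t by lra.
  exact: le_trans.
pose A c : set (measurableTypeR R) := [set x | 0 < x < t /\ c <= k x].
have AP c : measurable (A c) /\ \int[lebesgue_measure]_(x in A c) g x <= 0.
  apply: (integral_up_set_le0 t g (A c)) => //.
    by move=> x [+ _]; rewrite /= in_itv.
  move=> x y [/andP[x0 xt] cx] xy yt; split; first by rewrite yt (lt_le_trans x0).
  exact: le_trans (km _ _ x0 xy yt).
have subA c : A c `<=` D by move=> x [+ _]; rewrite /D/= in_itv.
pose d n : R := M / n.+1%:R.
have d0 n : 0 <= d n by rewrite divr_ge0.
pose h n (i : nat) (x : R) := d n * (g \_ (A (i.+1%:R * d n))) x.
have iA c : lebesgue_measure.-integrable D (EFin \o (g \_ (A c))).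
  rewrite -restrict_EFin; apply: (integrable_restrict _ (AP c).1 mD _).1.
  by rewrite (setIidr (subA _)); apply: integrableS ig => //; exact: (AP c).1.
have ih n i : lebesgue_measure.-integrable D (EFin \o h n i).
  exact: (integrableZl mD _ (iA _)).
have Ih n i : \int[lebesgue_measure]_(x in D) h n i x <= 0.
  rewrite RintegralZl//.
  rewrite mulr_ge0_le0// -Rintegral_mkcondr (setIidr (subA _)).
  exact: (AP _).2.
pose f_ n x := staircase (d n) (k x) n.+1 * g x.
have fE n x : D x -> f_ n x = \sum_(i < n.+1) h n i x.
  move=> Dx; rewrite /f_ /staircase mulr_suml; apply: eq_bigr => i _.
  rewrite /h patchE -mulrA; congr (_ * _).
  rewrite /D /= in_itv/= in Dx.
  case: ifPn => [|xA]; first by rewrite inE => -[_ ->]; rewrite mul1r.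
  by rewrite (_ : _ <= _ = false) ?mul0r//; apply: contraNF xA => kx; rewrite inE.
have SI n := integral_sum_le0 D (h n) n.+1 mD (ih n) (Ih n).
have fD n : \int[lebesgue_measure]_(x in D) f_ n x <= 0.
  rewrite (_ : \int[lebesgue_measure]_(x in D) f_ n x =
    \int[lebesgue_measure]_(x in D) \sum_(i < n.+1) h n i x); first exact: (SI n).2.
  by apply: eq_Rintegral => x; rewrite inE; exact: fE.
have mf_ n : measurable_fun D (EFin \o f_ n).
  have /integrableP[+ _] := (SI n).1; apply: eq_measurable_fun => x.
  by rewrite inE => Dx /=; rewrite fE.
have kD x : D x -> 0 <= k x <= M by rewrite /D/= in_itv/=; exact: kM.
have stair n x : D x -> k x - d n <= staircase (d n) (k x) n.+1 <= k x.
  by move=> Dx; apply: staircase_bounds => //; rewrite /d mulrC divfK// kD.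
have dcv : d n @[n --> \oo] --> (0 : R).
  suff : M * n.+1%:R^-1 @[n --> \oo] --> M * 0 by rewrite mulr0.
  by apply: cvgM; [exact: cvg_cst|exact: cvg_harmonic].
have fcv x : D x -> (EFin \o f_ n) x @[n --> \oo] --> (EFin \o (fun x => k x * g x)) x.
  move=> Dx; apply: cvg_EFin; first exact: nearW.
  apply: cvgM; last exact: cvg_cst.
  apply: (@squeeze_cvgr _ _ _ _ (fun n => k x - d n) (fun=> k x)).
  - by apply: nearW => n; exact: stair.
  - by rewrite -[X in _ --> X]subr0; apply: cvgB; [exact: cvg_cst|exact: dcv].
  - exact: cvg_cst.
pose kg x : R := k x * g x.
have mkg : measurable_fun D (EFin \o kg).
  by apply: (emeasurable_fun_cvg (fun n => EFin \o f_ n)) => // x Dx; exact: fcv.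
split; first exact/measurable_EFinP.
have iMg : lebesgue_measure.-integrable D (fun x => (M * `|g x|)%:E).
  have iag : lebesgue_measure.-integrable D (fun x => `|(EFin \o g) x|%E).
    exact: integrable_abse.
  exact: (integrableZl mD M iag).
have [_ _ H] : [/\ lebesgue_measure.-integrable D (EFin \o kg),
    [sequence \int[lebesgue_measure]_(x in D) `|(EFin \o f_ n) x - (EFin \o kg) x|]_n @ \oo --> 0 &
    [sequence \int[lebesgue_measure]_(x in D) ((EFin \o f_ n) x)]_n @ \oo -->
      \int[lebesgue_measure]_(x in D) ((EFin \o kg) x)]%E.
  apply: (dominated_convergence mD mf_ mkg _ iMg); apply: aeW => x; first exact: fcv.
  move=> n Dx; rewrite /= lee_fin normrM ler_wpM2r// ger0_norm.
    by have /andP[_ h1] := stair n x Dx; have /andP[_ h2] := kD x Dx; exact: le_trans h2.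
  by apply: sumr_ge0 => i _; rewrite mulr_ge0.
rewrite /Rintegral; apply: fine_le0; apply: (cvge_to_le H).
apply: nearW => n; rewrite -[X in (X <= _)%E]fineK ?lee_fin; first exact: fD.
apply: integrable_fin_num => //.
have := (SI n).1; apply: eq_integrable => // x; rewrite inE => Dx /=.
by rewrite fE.
Qed.

(** * The sign of the fractional derivative *)

Theorem theorem3p2 (R : realType) (alpha : R) (halpha : 0 < alpha < 1)
  (B : R -> R) (hBalpha : 0 < B alpha) (hB0 : B 0 = 1) (hB1 : B 1 = 1)
  (T : R) (hT : 0 < T) (m : R -> R)
  (hdiff : differentiable_on `[0, T] m)
  (hH1 : H1 T m)
  (hcont : {within `[0, T], continuous (ABC B alpha T m)})
  (tau0 : R) (htau0 : tau0 \in `]0, T])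
  (hm0 : m tau0 = 0)
  (hm : forall tau : R, tau \in `[0, tau0[ -> 0 <= m tau) :
  ABC B alpha T m tau0 <= 0.
Proof.
have /andP[a0 a1] := halpha.
have a01 : 0 < alpha <= 1 by rewrite a0 ltW.
have := htau0; rewrite in_itv/= => /andP[t0 tT].
have [L2g wd] : L2 T (weak_derivative T m) /\ is_weak_derivative T m (weak_derivative T m).
  by rewrite /weak_derivative; case: hH1 => _ ex; exact: (getPex ex).
rewrite /ABC; set c := alpha / (1 - alpha); set g := weak_derivative T m in L2g wd *.
have c0 : 0 <= c by rewrite divr_ge0 ?subr_ge0// ltW.
rewrite mulr_ge0_le0//; first by rewrite divr_ge0 ?subr_ge0// ltW.
have ig := L2_integrable T g L2g.
have igt : lebesgue_measure.-integrable `]0, tau0[ (EFin \o g).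
  by apply: integrableS ig => //; apply: subset_itvl; rewrite bnd_simp.
have cm := differentiable_on_continuous _ _ hdiff.
have gle s : 0 <= s < tau0 -> \int[lebesgue_measure]_(x in `]s, tau0[) g x <= 0.
  by move=> /andP[s0 st]; exact: (integral_weak_derivative_le0 T m).
pose k x := mittag_leffler alpha (- c * (tau0 - x) `^ alpha).
have kE x : k x = mittag_leffler alpha (- (c * (tau0 - x) `^ alpha)) by rewrite /k mulNr.
have y0 x : 0 <= c * (tau0 - x) `^ alpha by rewrite mulr_ge0 ?powR_ge0.
(* the weight is bounded by its value at tau0, i.e. at the argument - 0 *)
have [] := integral_nondecreasing_le0 tau0 (mittag_leffler alpha (- 0)) k g t0 gle igt.
- by move=> x _; rewrite kE; exact: mittag_leffler_bounds.
- move=> x y x0 xy yt; rewrite !kE.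
  suff /andP[] : 0 <= mittag_leffler alpha (- (c * (tau0 - x) `^ alpha)) <=
    mittag_leffler alpha (- (c * (tau0 - y) `^ alpha)) by [].
  apply: mittag_leffler_bounds => //; rewrite ler_wpM2l//.
  rewrite ge0_ler_powR ?nnegrE ?subr_ge0 ?(ltW a0) ?lerD2l ?lerN2// ?(ltW yt)//.
  by rewrite (le_trans xy)// ltW.
move=> mkg kg; move: kg; rewrite /Rintegral -(@integral_itv_bndoo _ _ _ _ true false)//.
exact/measurable_EFinP.
Qed.
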